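(* Let $X$, $\mathcal H_\alpha$, $\{k_x^\alpha\}_{x\in X}$, $\nu_\alpha$ be as described in the context. Assume that $d\nu_\alpha=c(\alpha)\,d\nu$ with $c(\alpha)>0$ and $\nu$ a Radon measure on $X$ independent of $\alpha$, and that for every $x\in X$ and every neighborhood $U$ of $x$, $\int_{X\setminus U}|\langle k_x^\alpha,k_y^\alpha\rangle_\alpha|^2\,d\nu_\alpha(y)\to0$ as $\alpha\to\infty$. Let $\sigma\in L^1(X,\nu)\cap L^2(X,\nu)$ be real-valued and either bounded or non-negative. Then for every $t\in\mathbb R$ such that $\nu(\{\sigma=t\})=0$, and every non-negative $\eta\in L^1(X,\nu)\cap L^2(X,\nu)$ such that $T_\sigma^\alpha$ and $T_\eta^\alpha$ commute for all $\alpha$, $$\lim_{\alpha\to\infty}\frac1{c(\alpha)}\sum_{j:\,\lambda_j^\alpha>t}\langle T_\eta^\alpha e_j^\alpha,e_j^\alpha\rangle_\alpha=\int_{\{\sigma>t\}}\eta(x)\,d\nu(x),$$ where $\{e_j^\alpha\}$ is an orthonormal eigenbasis of $T_\sigma^\alpha$ with corresponding eigenvalues $\{\lambda_j^\alpha\}$.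
   Context: $X$ is a locally compact Hausdorff space. For each value of a parameter $\alpha$ (limits are taken as $\alpha\to\infty$), $\mathcal H_\alpha$ is a Hilbert space with inner product $\langle\cdot,\cdot\rangle_\alpha$, and $\{k_x^\alpha:x\in X\}\subset\mathcal H_\alpha$ is a normalized continuous Parseval frame with frame Radon measure $\nu_\alpha$ on $X$: $\|k_x^\alpha\|_\alpha=1$ for all $x$, the functions $x\mapsto\langle f,k_x^\alpha\rangle_\alpha$ are Borel measurable, and $f=\int_X\langle f,k_x^\alpha\rangle_\alpha k_x^\alpha\,d\nu_\alpha(x)$ weakly for every $f\in\mathcal H_\alpha$. For $\sigma\in L^1(X,\nu)$ the Toeplitz operator is $T_\sigma^\alpha f=\int_X\sigma(x)\langle f,k_x^\alpha\rangle_\alpha k_x^\alpha\,d\nu_\alpha(x)$ (weakly defined); it is trace class, and self-adjoint for real-valued $\sigma$. *)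

(* Defs.v *)
From HB Require Import structures.
From mathcomp Require Import all_boot all_order all_algebra.
From mathcomp Require Import complex.
From mathcomp Require Import all_classical all_reals all_analysis.

Set Implicit Arguments.
Unset Strict Implicit.
Unset Printing Implicit Defensive.

Import Order.TTheory GRing.Theory Num.Theory.
Import numFieldNormedType.Exports.

Local Open Scope classical_set_scope.
Local Open Scope ring_scope.
Local Open Scope complex_scope.

(* Measurable types are pointed in the library, hence T : ptopologicalType. *)
Notation borel T := (g_sigma_algebraType (@open T)).

(* A complex Hilbert space. The inner product is linear in its first argument
   and conjugate-linear in the second one. *)
Record hilbert (R : realType) := Hilbert {
  hilbert_space :> completeNormedModType R[i] ;
  inner : {dot hilbert_space for @conjc R} ;
  inner_norm : forall f : hilbert_space, `|f| ^+ 2 = inner f f }.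

Notation "''<' f , g >" := (inner _ f g)
  (at level 0, f, g at level 69, format "''<' f ,  g >") : ring_scope.

(* The usual convention on locally compact Hausdorff spaces: outer regularity
   on Borel sets, inner regularity on open sets. *)
Record radon_measure (R : realType) (X : ptopologicalType)
    (mu : {measure set (borel X) -> \bar R}) : Prop := RadonMeasure {
  radon_compact : forall K : set X, compact K -> (mu K < +oo)%E ;
  radon_outer : forall B : set (borel X), measurable B ->
    mu B = ereal_inf [set mu U | U in [set U : set X | open U /\ B `<=` U]] ;
  radon_inner : forall U : set X, open U ->
    mu U = ereal_sup [set mu K | K in [set K : set X | compact K /\ K `<=` U]] }.

Definition cintegrable (R : realType) d (T : measurableType d)
    (mu : {measure set T -> \bar R}) (f : T -> R[i]) : Prop :=
  mu.-integrable setT (fun x => (complex.Re (f x))%:E) /\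
  mu.-integrable setT (fun x => (complex.Im (f x))%:E).

Definition cintegral (R : realType) d (T : measurableType d)
    (mu : {measure set T -> \bar R}) (f : T -> R[i]) : R[i] :=
  (\int[mu]_x complex.Re (f x)) +i* (\int[mu]_x complex.Im (f x)).

(* R[i]^o is the complex numbers with the topology given by the modulus. The
   weak reconstruction formula is tested against an arbitrary g; integrability
   is required because cintegral is total. *)
Record normalized_parseval_frame (R : realType) (X : ptopologicalType)
    (H : hilbert R) (mu : {measure set (borel X) -> \bar R}) (k : X -> H) :
    Prop := NormalizedParsevalFrame {
  frame_normalized : forall x, `|k x| = 1 ;
  frame_measurable : forall f : H,
    measurable_fun (setT : set (borel X))
      ((fun x => '<f, k x>) : borel X -> borel (R[i]^o)) ;
  frame_reproducing : forall f g : H,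
    @cintegrable R _ (borel X) mu (fun x => '<f, k x> * '<k x, g>) /\
    '<f, g> = @cintegral R _ (borel X) mu (fun x => '<f, k x> * '<k x, g>) }.

(* T_s f is the vector h such that, for all g,
   <h, g> = \int s(x) <f, k x> <k x, g> dmu(x). *)
Definition toeplitz (R : realType) (X : ptopologicalType)
    (H : hilbert R) (mu : {measure set (borel X) -> \bar R}) (k : X -> H)
    (s : X -> R[i]) (f : H) : H :=
  xget 0 [set h : H | forall g : H,
    '<h, g> = @cintegral R _ (borel X) mu
                (fun x => s x * '<f, k x> * '<k x, g>)].

Definition orthonormal_basis (R : realType) (H : hilbert R) (J : choiceType)
    (e : J -> H) : Prop :=
  (forall i j : J, '<e i, e j> = (i == j)%:R) /\
  dense [set f : H | exists (s : seq J) (a : J -> R[i]),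
                       f = \sum_(j <- s) a j *: e j].

(* Real eigenvalues: only used for self-adjoint T. *)
Definition orthonormal_eigenbasis (R : realType) (H : hilbert R)
    (T : H -> H) (J : choiceType) (e : J -> H) (lambda : J -> R) : Prop :=
  orthonormal_basis e /\ forall j, T (e j) = (lambda j)%:C *: e j.

(* Main.v *)
Require Import Defs.
From HB Require Import structures.
From mathcomp Require Import all_boot all_order all_algebra.
From mathcomp Require Import complex.
From mathcomp Require Import all_classical all_reals all_analysis.
From mathcomp Require Import measurable_realfun.
From mathcomp Require Import ring lra.

Set Implicit Arguments.
Unset Strict Implicit.
Unset Printing Implicit Defensive.

Import Order.TTheory GRing.Theory Num.Theory.
Import numFieldNormedType.Exports HBNNSimple.

Local Open Scope classical_set_scope.
Local Open Scope ring_scope.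
Local Open Scope complex_scope.

(* Write p_j(x) = |<e_j, k_x>|^2 and let nu_alpha = c nu. Since T_sigma e_j =
   lambda_j e_j and sum_j p_j <= 1, for every finite set F of indices
     int sigma^2 dnu - c^-1 sum_(j in F) lambda_j^2
       = int sigma^2 (1 - sum_F p_j) dnu + sum_F int (lambda_j - sigma)^2 p_j dnu,
   so both terms on the right are small once c^-1 |T_sigma|_HS^2 is close to
   |sigma|^2 in L2(nu). Then Chebyshev's inequality shows that p_j(x) is
   concentrated on the j with lambda_j close to sigma(x), so that the sum of
   <T_eta e_j, e_j> = int eta p_j dnu_alpha over lambda_j > t is close to
   c int eta dnu over {sigma > t}; no mass of eta escapes, by the same argument
   applied to sqrt (eta 1_{sigma > t}) in place of sigma.
   The convergence c^-1 |T_psi|_HS^2 -> |psi|^2 for all psi in L2(nu) follows by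
   density from the case psi = 1_U with U open of finite measure, where the
   Hilbert-Schmidt norm is the integral over U of int_U |<k_x, k_y>|^2 dnu_alpha(y),
   which tends to 1 for each x in U by localization.
   Products <f, k_x><k_x, g> enter only through their real parts [fprod f g x],
   whose integrals are the real inner products [ip f g]. *)

(** * The inner product of a complex Hilbert space *)

Section inner_product.
Context {R : realType} {H : hilbert R}.
Implicit Types (f g h : H) (a : R).

Lemma innerDl f g h : '<f + g, h> = '<f, h> + '<g, h>.
Proof. exact: (linearDl (inner H)). Qed.

Lemma innerZl (c : R[i]) f g : '<c *: f, g> = c * '<f, g>.
Proof. exact: (linearZl_LR (inner H)). Qed.

Lemma innerZr (c : R[i]) f g : '<f, c *: g> = conjc c * '<f, g>.
Proof. exact: (linearZr_LR (inner H)). Qed.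

Lemma innerC f g : '<f, g> = conjc '<g, f>.
Proof. by rewrite (hermC (inner H)) /= expr0 mul1r. Qed.

Definition ip f g : R := complex.Re '<f, g>.

Lemma ipC f g : ip f g = ip g f.
Proof. by rewrite /ip innerC; case: '<_, _>. Qed.

Lemma ReD (x y : R[i]) : complex.Re (x + y) = complex.Re x + complex.Re y.
Proof. by case: x; case: y. Qed.

Lemma ReZ a (x : R[i]) : complex.Re (a%:C * x) = a * complex.Re x.
Proof. by case: x => u v /=; rewrite mul0r subr0. Qed.

Lemma ImZ a (x : R[i]) : complex.Im (a%:C * x) = a * complex.Im x.
Proof. by case: x => u v /=; rewrite mul0r addr0. Qed.

Lemma ipDl f g h : ip (f + g) h = ip f h + ip g h.
Proof. by rewrite /ip innerDl ReD. Qed.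

Lemma ipZl a f g : ip (a%:C *: f) g = a * ip f g.
Proof. by rewrite /ip innerZl ReZ. Qed.

Lemma ipDr f g h : ip f (g + h) = ip f g + ip f h.
Proof. by rewrite ipC ipDl !(ipC f). Qed.

Lemma ipZr a f g : ip f (a%:C *: g) = a * ip f g.
Proof. by rewrite ipC ipZl ipC. Qed.

Lemma ipNl f g : ip (- f) g = - ip f g.
Proof. by rewrite -[- f]scaleN1r -(rmorphN1 (real_complex R)) ipZl mulN1r. Qed.

Lemma ipNr f g : ip f (- g) = - ip f g.
Proof. by rewrite ipC ipNl ipC. Qed.

Lemma ip0l f : ip 0 f = 0.
Proof. by rewrite -(scale0r (0 : H)) -(rmorph0 (real_complex R)) ipZl mul0r. Qed.

Lemma ip_suml (I : Type) (s : seq I) (F : I -> H) f :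
  ip (\sum_(i <- s) F i) f = \sum_(i <- s) ip (F i) f.
Proof.
elim: s => [|i s IHs]; first by rewrite !big_nil ip0l.
by rewrite !big_cons ipDl IHs.
Qed.

Lemma inner_id f : '<f, f> = (ip f f)%:C.
Proof.
by rewrite /ip; have := innerC f f; case: '<f, f> => u v [] /eqP; rewrite -addr_eq0
  -mulr2n mulrn_eq0 /= => /eqP ->.
Qed.

Definition nrm f : R := complex.Re `|f|.

Lemma nrmE f : `|f| = (nrm f)%:C.
Proof.
by rewrite /nrm RRe_real// realE normr_ge0.
Qed.

Lemma nrm_ge0 f : 0 <= nrm f.
Proof. by rewrite -ler0c -nrmE normr_ge0. Qed.

Lemma ip_nrm f : ip f f = nrm f ^+ 2.
Proof.
by apply: (@complexI R); rewrite -inner_id -inner_norm nrmE rmorphXn.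
Qed.

Lemma ip_ge0 f : 0 <= ip f f.
Proof. by rewrite ip_nrm sqr_ge0. Qed.

Lemma ip_eq0 f : ip f f = 0 -> f = 0.
Proof.
rewrite ip_nrm => /eqP; rewrite sqrf_eq0 => /eqP f0.
by apply: normr0_eq0; rewrite nrmE f0.
Qed.

Lemma ip_CS f g : ip f g ^+ 2 <= ip f f * ip g g.
Proof.
have [g0|g0] := eqVneq (ip g g) 0.
  by rewrite (ip_eq0 g0) ipC ip0l expr0n/= ip0l mulr0.
have gg : 0 < ip g g by rewrite lt_def g0 ip_ge0.
have := ip_ge0 ((ip g g)%:C *: f - (ip f g)%:C *: g).
rewrite !(ipDl, ipDr, ipNl, ipNr, ipZl, ipZr) (ipC g f).
set x := ip f f; set y := ip g g; set z := ip f g => h.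
have : 0 <= y * (x * y - z ^+ 2).
  by apply: le_trans h _; rewrite le_eqVlt; apply/orP; left; apply/eqP; ring.
by rewrite pmulr_rge0// subr_ge0.
Qed.

Lemma inner_inj f g : (forall h, '<f, h> = '<g, h>) -> f = g.
Proof.
move=> fg; apply/eqP; rewrite -subr_eq0; apply/eqP/ip_eq0.
by rewrite ipDl ipNl /ip fg subrr.
Qed.

(** The form [ip] determines the complex inner product, because testing against ['i *: g] recovers
    imaginary parts. Complex identities can therefore be proved on real parts alone. *)
Lemma inner_im f g : complex.Im '<f, g> = ip f ('i *: g).
Proof.
rewrite /ip innerZr; case: '<_, _> => u v /=.
by rewrite mul0r mulN1r opprK add0r.
Qed.

Lemma ip_inner f g : (forall h, ip f h = ip g h) -> f = g.
Proof.
move=> fg; apply: inner_inj => h; have := inner_im f h; have := inner_im g h.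
rewrite fg; have := fg h; rewrite /ip.
by case: '<f, h> => ? ?; case: '<g, h> => ? ? /= -> -> ->.
Qed.

Lemma parallelogram f g :
  ip (f + g) (f + g) + ip (f - g) (f - g) = 2 * ip f f + 2 * ip g g.
Proof.
by rewrite !(ipDl, ipDr, ipNl, ipNr); ring.
Qed.

Lemma ip_pythagoras f g : ip f g = 0 ->
  ip (f + g) (f + g) = ip f f + ip g g.
Proof. by move=> fg; rewrite !(ipDl, ipDr) (ipC g) fg; ring. Qed.

End inner_product.

(** * Completeness and the Riesz representation theorem *)

Section riesz.
Context {R : realType} {H : hilbert R}.
Implicit Types (f g h : H).

Lemma hilbert_complete (u : nat -> H) :
  (forall e, 0 < e -> exists N, forall i j, (N <= i)%N -> (N <= j)%N ->
     ip (u i - u j) (u i - u j) < e) ->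
  exists h, forall e, 0 < e -> exists N, forall n, (N <= n)%N ->
     ip (u n - h) (u n - h) < e.
Proof.
move=> u_cauchy.
have nrm_lt (e : R[i]) f : 0 < e -> ip f f < complex.Re e ^+ 2 -> `|f| < e.
  rewrite ltcE => /andP[/eqP Ime Ree]; rewrite ip_nrm nrmE ltcE /= Ime eqxx/=.
  by apply: contraTT; rewrite -!leNgt => ?; rewrite lerXn2r// nnegrE ?nrm_ge0// ltW.
have Re_gt0 (e : R[i]) : 0 < e -> 0 < complex.Re e by rewrite ltcE => /andP[].
have : cauchy (u @ \oo).
  apply: cauchy_exP => e e0.
  have [N uN] := u_cauchy _ (exprn_gt0 2 (Re_gt0 _ e0)).
  exists (u N); exists N => // n /= Nn.
  by rewrite -ball_normE/=; apply: nrm_lt => //; apply: uN.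
move/cauchy_cvg => /cvg_ex[h /= uh]; exists h => e e0.
have [s s0 se] : exists2 s : R, 0 < s & s ^+ 2 <= e.
  exists (Num.sqrt e); first by rewrite sqrtr_gt0.
  by rewrite sqr_sqrtr// ltW.
have /cvgrPdist_lt/(_ s%:C) := uh.
rewrite ltcR => /(_ s0)[N _ uN]; exists N => n Nn; apply: lt_le_trans se.
have := uN n Nn; rewrite distrC /= nrmE ltcR => us.
by rewrite ip_nrm ltrXn2r ?nrm_ge0.
Qed.

(** First-order condition at a minimum. The test value s = -d / (G + 1) makes the expression a
    nonpositive multiple of d^2, and [G + 1] avoids a separate case G = 0. *)
Lemma ip_quadratic_ge0 (d G : R) : 0 <= G ->
  (forall s, 0 <= 2 * s * d + s ^+ 2 * G) -> d = 0.
Proof.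
move=> G0 /(_ (- d / (G + 1))); set D := G + 1.
have D0 : 0 < D by rewrite ltr_wpDl.
have -> : 2 * (- d / D) * d + (- d / D) ^+ 2 * G =
  - (d ^+ 2 * ((G + 2) / D ^+ 2)).
  by rewrite /D; field; rewrite gt_eqF.
rewrite oppr_ge0 => h; apply/eqP; rewrite -sqrf_eq0 eq_le sqr_ge0 andbT.
by move: h; rewrite pmulr_lle0// divr_gt0 ?exprn_gt0// ltr_wpDl.
Qed.

(* The representing vector minimises |g|^2 - 2 Re (L g). *)
Lemma riesz (L : H -> R[i]) (C : R) :
  (forall f g, L (f + g) = L f + L g) ->
  (forall c g, L (c *: g) = conjc c * L g) ->
  0 <= C -> (forall g, complex.Re (L g) ^+ 2 <= C * ip g g) ->
  exists h, forall g, '<h, g> = L g.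
Proof.
move=> LD LZ C0 LC; pose l g := complex.Re (L g).
have lD f g : l (f + g) = l f + l g by rewrite /l LD ReD.
have lZ (a : R) g : l (a%:C *: g) = a * l g by rewrite /l LZ conjc_real ReZ.
pose F g := ip g g - 2 * l g.
have Fge g : - C <= F g.
  rewrite /F; have := LC g; have := ip_ge0 g; rewrite -/(l g).
  set x := ip g g; set y := l g => x0 yx.
  (* From y^2 <= C x and (x - C)^2 >= 0 one gets (2 y)^2 <= (x + C)^2. *)
  suff : 2 * y <= x + C by lra.
  have [y0|y0] := lerP y 0; first by lra.
  rewrite -(@ler_pXn2r _ 2)// ?nnegrE; [|lra|lra].
  by have := sqr_ge0 (x - C); nra.
pose m := inf (range F).
have Fm g : m <= F g.
  apply: ge_inf; last by exists g.
  by exists (- C) => _ [f _ <-].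
have : forall n : nat, exists g, F g < m + n.+1%:R^-1.
  move=> n; have : has_inf (range F).
    split; first by exists (F 0); exists 0.
    by exists (- C) => _ [f _ <-].
  move=> /(inf_adherent (_ : 0 < n.+1%:R^-1)); rewrite invr_gt0 ltr0n.
  by move=> /(_ isT)[_ [g _ <-]]; exists g.
move=> /choice[u uF].
(* Parallelogram law for [F], in which the linear part cancels. Since [F] is at least [m] at the
   midpoint, near-minimisers are close to each other, so [u] is Cauchy. *)
have Fpar f g : ip (f - g) (f - g) =
    2 * F f + 2 * F g - 4 * F ((2^-1)%:C *: (f + g)).
  rewrite /F !(lD, lZ, ipDl, ipDr, ipNl, ipNr, ipZl, ipZr) (ipC g f).
  by field.
have inv_small (e : R) : 0 < e -> exists N : nat, forall n, (N <= n)%N -> n.+1%:R^-1 < e.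
  move=> e0; have [N _ hN] := near_infty_natSinv_lt (PosNum e0).
  by exists N => n Nn; apply: hN.
have [|h uh] := @hilbert_complete u.
  move=> e e0; have [N hN] := inv_small (e / 4) ltac:(by rewrite divr_gt0).
  exists N => i j Ni Nj; rewrite Fpar.
  have := Fm ((2^-1)%:C *: (u i + u j)).
  have := uF i; have := uF j; have := hN _ Ni; have := hN _ Nj.
  move: (F (u i)) (F (u j)) (F _) (i.+1%:R^-1) (j.+1%:R^-1) => a b c v w.
  lra.
(* Vanishing first variation: [F (u n + s g) >= m] and [F (u n) < m + 1/(n+1)] bound the variation
   in direction [g] from below. Replacing [u n] by its limit [h] costs another e / 2. *)
have hl g : ip h g = l g.
  apply/eqP; rewrite -subr_eq0; apply/eqP.
  apply: (@ip_quadratic_ge0 _ (ip g g)) => [|s]; first exact: ip_ge0.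
  apply/ler_addgt0Pl => e e0.
  have [N1 hN1] := inv_small (e / 2) ltac:(by rewrite divr_gt0).
  (* By Cauchy-Schwarz, (2 s <u n - h, g>)^2 is at most [B] times the squared norm of [u n - h]; the
     later division by [B + 1] stays valid when [B = 0]. *)
  pose B := 4 * s ^+ 2 * ip g g.
  have B0 : 0 <= B by apply: mulr_ge0; [exact: mulr_ge0 (sqr_ge0 _)|exact: ip_ge0].
  have [|N2 hN2] := uh ((e / 2) ^+ 2 / (B + 1)).
    by rewrite divr_gt0// ?ltr_wpDl// exprn_gt0// divr_gt0.
  pose n := maxn N1 N2.
  have := hN1 n (leq_maxl _ _); have := hN2 n (leq_maxr _ _).
  have := uF n; have := Fm (u n + s%:C *: g).
  have := ip_CS (u n - h) g.
  rewrite /F !(lD, lZ, ipDl, ipDr, ipNl, ipNr, ipZl, ipZr) (ipC g (u n)) (ipC h (u n)).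
  set X := (X in _ <= X * _); set a := ip (u n) g; set b := ip h g.
  set w := n.+1%:R^-1; rewrite ltr_pdivlMr; last by rewrite ltr_wpDl.
  move=> cs Fs Fu XB we.
  have X0 : 0 <= X.
    have := ip_ge0 (u n - h).
    by rewrite !(ipDl, ipDr, ipNl, ipNr) (ipC h (u n)).
  have : 2 * s * (a - b) <= e / 2.
    have [/le_trans->//|y0] := lerP (2 * s * (a - b)) 0; first by lra.
    rewrite -(@ler_pXn2r _ 2)// ?nnegrE; [|lra|lra].
    apply/ltW/(le_lt_trans _ XB); rewrite exprMn mulrDr mulr1.
    apply: (@le_trans _ _ (X * B)); last by rewrite lerDl.
    rewrite /B exprMn; have := sqr_ge0 s => s2; nra.
  lra.
exists h => g.
have := hl g; have := hl ('i *: g); rewrite -inner_im /l LZ /ip.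
case: '<h, g> => x y /=; case: (L g) => u' v' /= -> ->.
by rewrite mul0r mulN1r opprK add0r.
Qed.

End riesz.

(** * Integrals of real functions *)

Notation rintegrable mu f := (mu.-integrable setT (EFin \o f)).

Section real_integrable.
Context {d} {T : measurableType d} {R : realType}.
Variable mu : {measure set T -> \bar R}.
Implicit Types f g : T -> R.

Lemma rintegrable_measurable f : rintegrable mu f -> measurable_fun setT f.
Proof. by move/integrableP => [/measurable_EFinP]. Qed.

Lemma eq_rintegrable f g : f =1 g -> rintegrable mu f -> rintegrable mu g.
Proof. by move=> /funext ->. Qed.

Lemma rintegrableD f g : rintegrable mu f -> rintegrable mu g ->
  rintegrable mu (fun x => f x + g x).
Proof. by move=> fi gi; exact: (integrableD measurableT fi gi). Qed.

Lemma rintegrableZ a f : rintegrable mu f -> rintegrable mu (fun x => a * f x).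
Proof. by move=> fi; exact: (integrableZl measurableT a fi). Qed.

Lemma rintegrableB f g : rintegrable mu f -> rintegrable mu g ->
  rintegrable mu (fun x => f x - g x).
Proof. by move=> fi gi; exact: (integrableB measurableT fi gi). Qed.

Lemma rintegrable_le f g : measurable_fun setT f -> (forall x, `|f x| <= g x) ->
  rintegrable mu g -> rintegrable mu f.
Proof.
move=> mf fg; apply: le_integrable => //; first exact/measurable_EFinP.
by move=> x _; rewrite /= lee_fin (le_trans (fg x))// ler_norm.
Qed.

Lemma rintegrable_sum (I : Type) (s : seq I) (F : I -> T -> R) :
  (forall i, rintegrable mu (F i)) ->
  rintegrable mu (fun x => \sum_(i <- s) F i x).
Proof.
move=> iF; elim: s => [|i s IHs].
  under [X in _.-integrable _ (_ \o X)]eq_fun do rewrite big_nil.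
  exact: (integrable0 mu setT).
under [X in _.-integrable _ (_ \o X)]eq_fun do rewrite big_cons.
exact: rintegrableD.
Qed.

Lemma Rintegral_sum (I : Type) (s : seq I) (F : I -> T -> R) :
  (forall i, rintegrable mu (F i)) ->
  \int[mu]_x (\sum_(i <- s) F i x) = \sum_(i <- s) \int[mu]_x F i x.
Proof.
move=> iF; elim: s => [|i s IHs].
  by rewrite big_nil; under eq_Rintegral do rewrite big_nil;
    rewrite Rintegral_cst// mul0r.
rewrite big_cons -IHs -RintegralD//; last exact: rintegrable_sum.
by apply: eq_Rintegral => x _; rewrite big_cons.
Qed.

End real_integrable.

(** For a > 0, evaluate at the minimiser s = -b / a, where the value is (a c - b^2) / a. For a = 0
    the expression is affine in s, and a nonzero b would allow the value -1. *)
Lemma discriminant_le (R : realFieldType) (a b c : R) : 0 <= a -> 0 <= c ->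
  (forall s, 0 <= s ^+ 2 * a + 2 * s * b + c) -> b ^+ 2 <= a * c.
Proof.
move=> a0 c0 h; have [a_eq0|an0] := eqVneq a 0.
  have [->|b0] := eqVneq b 0; first by rewrite expr0n mulr_ge0.
  have := h (- (c + 1) / (2 * b)); rewrite a_eq0 mulr0 add0r.
  have -> : 2 * (- (c + 1) / (2 * b)) * b + c = - 1.
    by field; rewrite b0.
  by rewrite oppr_ge0 ler10.
have {an0}ap : 0 < a by rewrite lt_def an0.
have := h (- b / a).
have -> : (- b / a) ^+ 2 * a + 2 * (- b / a) * b + c = (a * c - b ^+ 2) / a.
  by field; rewrite gt_eqF.
by rewrite pmulr_lge0 ?invr_gt0// subr_ge0.
Qed.

(** * Square integrable functions *)

Definition L2 d (T : measurableType d) (R : realType)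
    (mu : {measure set T -> \bar R}) (psi : T -> R) :=
  measurable_fun setT psi /\ rintegrable mu (fun x => psi x ^+ 2).

Section square_integrable.
Context {d} {T : measurableType d} {R : realType}.
Variable mu : {measure set T -> \bar R}.
Implicit Types psi phi : T -> R.

Lemma L2D psi phi : L2 mu psi -> L2 mu phi -> L2 mu (fun x => psi x + phi x).
Proof.
move=> [mpsi ipsi] [mphi iphi]; split; first exact: measurable_funD.
apply: (rintegrable_le (g := fun x => 2 * psi x ^+ 2 + 2 * phi x ^+ 2)).
- by apply: measurable_funX; exact: measurable_funD.
- move=> x; rewrite ger0_norm ?sqr_ge0//.
  by have := sqr_ge0 (psi x - phi x); nra.
- by apply: rintegrableD; exact: rintegrableZ.
Qed.

Lemma L2Z a psi : L2 mu psi -> L2 mu (fun x => a * psi x).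
Proof.
move=> [mpsi ipsi]; split; first exact: measurable_funM.
apply: eq_rintegrable (rintegrableZ (a ^+ 2) ipsi) => x.
by rewrite exprMn.
Qed.

Lemma L2B psi phi : L2 mu psi -> L2 mu phi -> L2 mu (fun x => psi x - phi x).
Proof.
move=> Lpsi /(L2Z (-1)) /(L2D Lpsi).
by rewrite (_ : (fun x => _) = (fun x => psi x - phi x))//;
  apply/funext => x; rewrite mulN1r.
Qed.

End square_integrable.

Section dominated.
Context {d} {T : measurableType d} {R : realType}.
Variable mu : {measure set T -> \bar R}.

Lemma Rintegral_dominated (f_ : nat -> T -> R) (f g : T -> R) :
  (forall n, measurable_fun setT (f_ n)) ->
  (forall x, f_ n x @[n --> \oo] --> f x) ->
  rintegrable mu g -> (forall n x, `|f_ n x| <= g x) ->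
  rintegrable mu f /\ \int[mu]_x f_ n x @[n --> \oo] --> \int[mu]_x f x.
Proof.
move=> mf_ ff ig fg.
have mf : measurable_fun setT f.
  by apply: (measurable_fun_cvg mf_) => x _; exact: ff.
have [|||||fi _ cf] := @dominated_convergence _ _ _ mu setT measurableT
  (fun n x => (f_ n x)%:E) (EFin \o f) (EFin \o g).
- by move=> n; exact/measurable_EFinP.
- exact/measurable_EFinP.
- by apply: aeW => x _; apply: cvg_EFin; [exact: nearW|exact: ff].
- exact: ig.
- by apply: aeW => x n _; rewrite /= lee_fin.
split=> //.
have := fine_cvg (cvg_trans _ (_ : _ --> (\int[mu]_x f x)%:E)).
apply; last first.
  by rewrite /Rintegral fineK; [exact: cf|exact: integrable_fin_num].
by apply: cvg_id.
Qed.

End dominated.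

(** * Toeplitz operators with square integrable symbols *)

Section frame_products.
Context {R : realType} {X : ptopologicalType} {H : hilbert R}.
Variable k : X -> H.
Implicit Types (f g h : H) (x : borel X) (a : R).

Definition fprod f g x : R := complex.Re ('<f, k x> * '<k x, g>).

Lemma fprod_ip f g x : fprod f g x = ip ('<f, k x> *: k x) g.
Proof. by rewrite /ip innerZl. Qed.

Lemma fprod_im f g x :
  complex.Im ('<f, k x> * '<k x, g>) = fprod f ('i *: g) x.
Proof. by rewrite fprod_ip -inner_im innerZl. Qed.

Lemma fprodC f g x : fprod f g x = fprod g f x.
Proof.
rewrite /fprod (innerC f) (innerC (k x) g).
by case: '<k x, f> => a b; case: '<g, k x> => c d /=; ring.
Qed.

Lemma fprodDr f g h x : fprod f (g + h) x = fprod f g x + fprod f h x.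
Proof. by rewrite !fprod_ip ipDr. Qed.

Lemma fprodZr a f g x : fprod f (a%:C *: g) x = a * fprod f g x.
Proof. by rewrite !fprod_ip ipZr. Qed.

Lemma fprodNr f g x : fprod f (- g) x = - fprod f g x.
Proof. by rewrite !fprod_ip ipNr. Qed.

Lemma fprodDl f g h x : fprod (f + g) h x = fprod f h x + fprod g h x.
Proof. by rewrite !(fprodC _ h) fprodDr. Qed.

Lemma fprodZl a f g x : fprod (a%:C *: f) g x = a * fprod f g x.
Proof. by rewrite !(fprodC _ g) fprodZr. Qed.

Lemma fprodNl f g x : fprod (- f) g x = - fprod f g x.
Proof. by rewrite !(fprodC _ g) fprodNr. Qed.

Lemma fprod_ge0 f x : 0 <= fprod f f x.
Proof.
by rewrite /fprod (innerC (k x)); case: '<f, k x> => a b /=;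
  rewrite mulrN opprK addr_ge0// -expr2 sqr_ge0.
Qed.

Lemma fprod_normE f x : fprod f f x = complex.Re (`|'<f, k x>| ^+ 2).
Proof.
rewrite -add_Re2_Im2 /fprod (innerC (k x)); case: '<f, k x> => a b /=.
by rewrite mulrN opprK !expr2.
Qed.

(** Cauchy-Schwarz for <f, k x> k x and f: since [k x] is a unit vector, it reads p^2 <= p q with p
    = [fprod f f x] and q = [ip f f], and p cancels. *)
Lemma fprod_le f x : `|k x| = 1 -> fprod f f x <= ip f f.
Proof.
move=> kx1; have nk : ip (k x) (k x) = 1.
  by rewrite ip_nrm /nrm kx1 expr1n.
have := ip_CS ('<f, k x> *: k x) f; rewrite -fprod_ip.
have -> : ip ('<f, k x> *: k x) ('<f, k x> *: k x) = fprod f f x.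
  rewrite /ip innerZl innerZr mulrA inner_id nk mulr1 /fprod.
  by rewrite (innerC (k x)).
have := fprod_ge0 f x; have := ip_ge0 f.
set p := fprod f f x; set q := ip f f => q0 p0.
rewrite expr2; have [->//|pn0] := eqVneq p 0.
by rewrite ler_pM2l// lt_def pn0.
Qed.

End frame_products.

Section frame_integrals.
Context {R : realType} {X : ptopologicalType} {H : hilbert R}.
Variables (mu : {measure set (borel X) -> \bar R}) (k : X -> H).
Hypothesis kF : normalized_parseval_frame mu k.
Local Notation m := (fprod k).
Local Notation toep psi := (toeplitz mu k (fun x => (psi x)%:C)).
Implicit Types (f g h : H) (psi phi : borel X -> R).

Lemma fprod_integrable f g : rintegrable mu (m f g).
Proof. by have [[]] := frame_reproducing kF f g. Qed.

Lemma Rintegral_fprod f g : \int[mu]_x m f g x = ip f g.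
Proof. by have [_] := frame_reproducing kF f g; rewrite /ip => ->. Qed.

Lemma measurable_fprod f g : measurable_fun setT (m f g).
Proof. exact: rintegrable_measurable (fprod_integrable f g). Qed.

Lemma fprod_le_ip f x : m f f x <= ip f f.
Proof. by apply: fprod_le; exact: frame_normalized kF x. Qed.

Lemma sqr_fprod_integrable psi f : L2 mu psi ->
  rintegrable mu (fun x => psi x ^+ 2 * m f f x).
Proof.
move=> [mpsi ipsi].
apply: (rintegrable_le (g := fun x => ip f f * psi x ^+ 2)).
- apply: measurable_funM; [exact: measurable_funX|exact: measurable_fprod].
- move=> x; rewrite ger0_norm.
    by rewrite mulrC ler_wpM2r ?sqr_ge0 ?fprod_le_ip.
  by apply: mulr_ge0; [exact: sqr_ge0|exact: fprod_ge0].
- exact: rintegrableZ.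
Qed.

(** Positivity of [m] at the vectors psi(x) f + g and psi(x) f - g bounds 2 |psi m f g| pointwise by
    psi^2 m f f + m g g. *)
Lemma mul_fprod_integrable psi f g : L2 mu psi ->
  rintegrable mu (fun x => psi x * m f g x).
Proof.
move=> Lpsi.
apply: (rintegrable_le (g := fun x => psi x ^+ 2 * m f f x + m g g x)).
- by apply: measurable_funM; [case: Lpsi|exact: measurable_fprod].
- move=> x; have := fprod_ge0 k ((psi x)%:C *: f + g) x.
  have := fprod_ge0 k ((psi x)%:C *: f - g) x.
  have := fprod_ge0 k f x; have := fprod_ge0 k g x.
  rewrite !(fprodDl, fprodDr, fprodNl, fprodNr, fprodZl, fprodZr) (fprodC k g f).
  move: (psi x) (m f f x) (m g g x) (m f g x) => p a b c b0 a0.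
  have := mulr_ge0 (sqr_ge0 p) a0.
  by rewrite ler_norml; move=> *; apply/andP; split; lra.
- by apply: rintegrableD; [exact: sqr_fprod_integrable|exact: fprod_integrable].
Qed.

(** Integrate the nonnegative function [m] at the vector s psi(x) f + g; the reproducing formula
    evaluates the last term. The discriminant of this quadratic in [s] is the bound that [riesz]
    asks for. *)
Lemma int_quadratic psi f g s : L2 mu psi ->
  0 <= s ^+ 2 * \int[mu]_x (psi x ^+ 2 * m f f x) +
       2 * s * \int[mu]_x (psi x * m f g x) + ip g g.
Proof.
move=> Lpsi.
have i1 := sqr_fprod_integrable f Lpsi; have i2 := mul_fprod_integrable f g Lpsi.
have i3 := rintegrableZ (s ^+ 2) i1; have i4 := rintegrableZ (2 * s) i2.
rewrite -Rintegral_fprod -!RintegralZl// -RintegralD// -RintegralD//; last 2 first.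
- exact: rintegrableD.
- exact: fprod_integrable.
apply: Rintegral_ge0 => x _.
have := fprod_ge0 k ((s * psi x)%:C *: f + g) x.
rewrite !(fprodDl, fprodDr, fprodZl, fprodZr) (fprodC k g f).
by move=> /le_trans; apply; rewrite le_eqVlt; apply/orP; left; apply/eqP; ring.
Qed.

(** The weak integral is a bounded conjugate-linear functional of [g], so [riesz] represents it.
    Hence the default value 0 of [xget] in [toeplitz] is not what defines the operator here. *)
Lemma toeplitz_inner psi f g : L2 mu psi ->
  '<toep psi f, g> = cintegral mu
    ((fun x => (psi x)%:C * '<f, k x> * '<k x, g>) : borel X -> _).
Proof.
move=> Lpsi.
pose L g : R[i] := cintegral mu
  ((fun x => (psi x)%:C * '<f, k x> * '<k x, g>) : borel X -> _).
pose l g := \int[mu]_x (psi x * m f g x).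
have LE g' : L g' = l g' +i* l ('i *: g').
  by congr Complex; apply: eq_Rintegral => x _; rewrite -mulrA ?ReZ ?ImZ ?fprod_im.
have lD g1 g2 : l (g1 + g2) = l g1 + l g2.
  rewrite -RintegralD//; [|exact: mul_fprod_integrable..].
  by apply: eq_Rintegral => x _; rewrite fprodDr mulrDr.
have lZ (a : R) g' : l (a%:C *: g') = a * l g'.
  rewrite -RintegralZl//; [|exact: mul_fprod_integrable].
  by apply: eq_Rintegral => x _; rewrite fprodZr mulrCA.
have LD g1 g2 : L (g1 + g2) = L g1 + L g2.
  by rewrite !LE scalerDr !lD.
have LZ c g' : L (c *: g') = conjc c * L g'.
  (* [l] is only real-linear, so multiplication by [c] is split into its real and imaginary
     parts. *)
  have cE : c *: g' = (complex.Re c)%:C *: g' + (complex.Im c)%:C *: ('i *: g').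
    by rewrite scalerA -scalerDl {1}[c]complexE [X in _ + X]mulrC.
  have ii (v : H) : 'i *: ('i *: v) = (- 1)%:C *: v.
    by rewrite scalerA -expr2 sqr_i rmorphN1.
  have iC (a : R) (v : H) : 'i *: (a%:C *: v) = a%:C *: ('i *: v).
    by rewrite !scalerA mulrC.
  rewrite cE !LE scalerDr !iC ii !lD !lZ.
  by case: c {cE} => a b; apply/eqP; rewrite eq_complex /=; apply/andP; split;
    apply/eqP; ring.
have [h hL] : exists h, forall g', '<h, g'> = L g'.
  apply: (riesz (C := \int[mu]_x (psi x ^+ 2 * m f f x)) LD LZ).
    by apply: Rintegral_ge0 => x _; rewrite mulr_ge0 ?sqr_ge0 ?fprod_ge0.
  move=> g'; rewrite LE /=; apply: discriminant_le; [|exact: ip_ge0|].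
    by apply: Rintegral_ge0 => x _; rewrite mulr_ge0 ?sqr_ge0 ?fprod_ge0.
  by move=> s; exact: int_quadratic.
rewrite /toeplitz; set S := [set h | _].
by have /(_ g) := @xgetPex _ 0 S (ex_intro _ h hL).
Qed.

Lemma ip_toeplitz psi f g : L2 mu psi ->
  ip (toep psi f) g = \int[mu]_x (psi x * m f g x).
Proof.
move=> Lpsi; rewrite /ip toeplitz_inner//=.
by apply: eq_Rintegral => x _; rewrite -mulrA ReZ.
Qed.

Lemma toeplitzD psi phi f : L2 mu psi -> L2 mu phi ->
  toep (fun x => psi x + phi x) f = toep psi f + toep phi f.
Proof.
move=> Lpsi Lphi; apply: ip_inner => h; rewrite ipDl !ip_toeplitz//; last exact: L2D.
rewrite -RintegralD//; [|exact: mul_fprod_integrable..].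
by apply: eq_Rintegral => x _; rewrite mulrDl.
Qed.

Lemma toeplitzB psi phi f : L2 mu psi -> L2 mu phi ->
  toep (fun x => psi x - phi x) f = toep psi f - toep phi f.
Proof.
move=> Lpsi Lphi; apply: ip_inner => h.
rewrite ipDl ipNl !ip_toeplitz//; last exact: L2B.
rewrite -RintegralB//; [|exact: mul_fprod_integrable..].
by apply: eq_Rintegral => x _; rewrite mulrBl.
Qed.

Lemma toeplitzZ a psi f : L2 mu psi ->
  toep (fun x => a * psi x) f = a%:C *: toep psi f.
Proof.
move=> Lpsi; apply: ip_inner => h; rewrite ipZl !ip_toeplitz//; last exact: L2Z.
rewrite -RintegralZl//; [|exact: mul_fprod_integrable].
by apply: eq_Rintegral => x _; rewrite mulrA.
Qed.

Lemma toeplitz_sa psi f g : L2 mu psi -> '<toep psi f, g> = '<f, toep psi g>.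
Proof.
move=> Lpsi; rewrite [RHS]innerC !toeplitz_inner//; apply/eqP.
rewrite eq_complex /= -mulN1r -RintegralZl//; last first.
  apply: eq_rintegrable (mul_fprod_integrable g ('i *: f) Lpsi) => x.
  by rewrite -mulrA ImZ fprod_im.
apply/andP; split; apply/eqP; apply: eq_Rintegral => x _.
  by rewrite -!mulrA !ReZ -!/(fprod k _ _ x) fprodC.
rewrite -!mulrA !ImZ (innerC f) (innerC (k x) g) mulrCA; congr (_ * _).
by case: '<k x, f> => a b; case: '<g, k x> => c d /=; ring.
Qed.

(** Write [h] for the image of [f] and expand the right-hand side. The integral of psi m f h is <h,
    h> by the weak definition of [h], and that of m h h is <h, h> by the reproducing formula. *)
Lemma defectE psi f : L2 mu psi ->
  \int[mu]_x (psi x ^+ 2 * m f f x) - ip (toep psi f) (toep psi f) =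
  \int[mu]_x m (toep psi f - (psi x)%:C *: f) (toep psi f - (psi x)%:C *: f) x.
Proof.
move=> Lpsi; set h := toep psi f.
have i1 := sqr_fprod_integrable f Lpsi; have i2 := mul_fprod_integrable f h Lpsi.
have i3 := fprod_integrable h h.
have e2 : \int[mu]_x (psi x * m f h x) = ip h h by rewrite -ip_toeplitz.
transitivity (\int[mu]_x (psi x ^+ 2 * m f f x + m h h x - 2 * (psi x * m f h x))).
  rewrite RintegralB//; [|exact: rintegrableD|exact: rintegrableZ].
  by rewrite RintegralD// RintegralZl// Rintegral_fprod e2; ring.
apply: eq_Rintegral => x _.
by rewrite !(fprodDl, fprodDr, fprodNl, fprodNr, fprodZl, fprodZr) (fprodC k f h); ring.
Qed.

Lemma defect_integrable psi f : L2 mu psi ->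
  rintegrable mu (fun x => m (toep psi f - (psi x)%:C *: f)
                             (toep psi f - (psi x)%:C *: f) x).
Proof.
move=> Lpsi; set h := toep psi f.
have i1 := sqr_fprod_integrable f Lpsi; have i2 := mul_fprod_integrable f h Lpsi.
have i3 := fprod_integrable h h.
apply: eq_rintegrable (rintegrableB (rintegrableD i1 i3) (rintegrableZ 2 i2)).
move=> x.
by rewrite !(fprodDl, fprodDr, fprodNl, fprodNr, fprodZl, fprodZr) (fprodC k f h); ring.
Qed.

Lemma toeplitz_norm_le psi f : L2 mu psi ->
  ip (toep psi f) (toep psi f) <= \int[mu]_x (psi x ^+ 2 * m f f x).
Proof.
move=> Lpsi; rewrite -subr_ge0 defectE//.
by apply: Rintegral_ge0 => x _; exact: fprod_ge0.
Qed.

End frame_integrals.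

(** * Orthonormal families *)

(** Otherwise there would be duplicate-free lists of every length with all terms above [d], and a
    list longer than C / d would have a sum above [C]. *)
Lemma sum_bounded_large (R : realType) (J : eqType) (a : J -> R) (C d : R) :
  (forall F : seq J, uniq F -> \sum_(i <- F) a i <= C) -> 0 < d ->
  exists F : seq J, uniq F /\ forall i, d < a i -> i \in F.
Proof.
move=> aC d0; apply/not_existsP => noF.
have big n : exists F : seq J, [/\ uniq F, size F = n & forall i, i \in F -> d < a i].
  elim: n => [|n [F [uF sF dF]]]; first by exists [::].
  have /not_andP[//|/existsNP[i /not_implyP[di /negP iF]]] := noF F.
  exists (i :: F); split => //=; [by rewrite iF|by rewrite sF|].
  by move=> j; rewrite inE => /predU1P[->//|/dF].
have [F [uF sF dF]] := big (Num.bound (C / d)).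
have := aC F uF; apply/negP; rewrite -ltNge.
apply: (@lt_le_trans _ _ (d *+ size F)).
  rewrite sF -mulr_natl -ltr_pdivrMr//.
  apply: archi_boundP; apply: divr_ge0; last exact: ltW.
  by have := aC [::] isT; rewrite big_nil.
rewrite -sum1_size -sumrMnr big_seq [leRHS]big_seq.
by apply: ler_sum => i iF; exact: ltW (dF _ iF).
Qed.

Section orthonormal.
Context {R : realType} {H : hilbert R} {J : choiceType}.
Variable e : J -> H.
Hypothesis e_orth : forall i j, '<e i, e j> = (i == j)%:R.
Implicit Types (F G s : seq J) (f g : H).

Definition proj F f : H := \sum_(i <- F) '<f, e i> *: e i.

Lemma inner_suml (s : seq J) (a : J -> H) g :
  '<\sum_(i <- s) a i, g> = \sum_(i <- s) '<a i, g>.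
Proof. exact: (linear_sumlz (inner H)). Qed.

Lemma inner_proj F f i : uniq F -> i \in F -> '<proj F f, e i> = '<f, e i>.
Proof.
move=> uF iF; rewrite inner_suml (bigD1_seq i)//= innerZl e_orth eqxx mulr1.
rewrite big1 ?addr0// => j ji; rewrite innerZl e_orth.
by rewrite (negbTE ji) mulr0.
Qed.

Lemma proj_orth F f s (a : J -> R[i]) : uniq F -> {subset s <= F} ->
  ip (f - proj F f) (\sum_(i <- s) a i *: e i) = 0.
Proof.
move=> uF sF; rewrite ipC ip_suml big_seq big1// => i /sF iF.
rewrite ipC /ip innerZr innerDl -scaleN1r innerZl inner_proj//.
by rewrite mulN1r subrr mulr0.
Qed.

Lemma proj_best F f s (a : J -> R[i]) : uniq F -> {subset s <= F} ->
  ip (f - proj F f) (f - proj F f) <=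
  ip (f - \sum_(i <- s) a i *: e i) (f - \sum_(i <- s) a i *: e i).
Proof.
move=> uF sF; set g := \sum_(i <- s) _.
have -> : f - g = (f - proj F f) + (proj F f - g) by rewrite addrA subrK.
rewrite [leRHS]ip_pythagoras ?lerDl ?ip_ge0//.
by rewrite ipDr ipNr !proj_orth// subrr.
Qed.

Lemma ip_proj F f : uniq F ->
  ip (proj F f) (proj F f) = \sum_(i <- F) complex.Re ('<f, e i> * '<e i, f>).
Proof.
move=> uF; have -> : ip (proj F f) (proj F f) = ip f (proj F f).
  apply/eqP; rewrite eq_sym -subr_eq0 -ipNl -ipDl; apply/eqP.
  exact: proj_orth.
by rewrite ipC ip_suml; apply: eq_bigr => i _; rewrite /ip innerZl.
Qed.

Lemma bessel F f : uniq F -> ip (proj F f) (proj F f) <= ip f f.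
Proof.
move=> uF; have {3 4}-> : f = (f - proj F f) + proj F f by rewrite subrK.
by rewrite [leRHS]ip_pythagoras ?lerDr ?ip_ge0// proj_orth.
Qed.

(** Density yields one combination of basis vectors within sqrt d of [f]. For [F] containing its
    index list [s], the projection is at least as close by [proj_best]. *)
Lemma proj_dense f (d : R) :
  dense [set g : H | exists (s : seq J) (a : J -> R[i]),
                       g = \sum_(j <- s) a j *: e j] ->
  0 < d -> exists s, forall F, uniq F -> {subset s <= F} ->
    ip (f - proj F f) (f - proj F f) < d.
Proof.
move=> e_dense d0.
pose r := Num.sqrt d; have r0 : 0 < r by rewrite sqrtr_gt0.
have rC0 : 0 < r%:C by rewrite ltcR.
have [|g [fg [s [a ga]]]] := e_dense (ball f r%:C) _ (ball_open f _).
  by exists f; exact: ballxx.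
exists s => F uF sF; apply: le_lt_trans (proj_best f a uF sF) _.
rewrite -ga ip_nrm -(sqr_sqrtr (ltW d0)) ltrXn2r ?nrm_ge0//.
by move: fg; rewrite -ball_normE /= nrmE ltcR.
Qed.

End orthonormal.

(** * Partial Hilbert-Schmidt norms *)

Lemma sum_subset (R : zmodType) (J : eqType) (F G : seq J) (a : J -> R) :
  uniq F -> uniq G -> {subset F <= G} ->
  \sum_(i <- G) a i = \sum_(i <- F) a i + \sum_(i <- G | i \notin F) a i.
Proof.
move=> uF uG FG; rewrite (bigID (mem F))/=; congr (_ + _).
rewrite -big_filter; apply: perm_big; apply: uniq_perm; rewrite ?filter_uniq//.
by move=> i; rewrite mem_filter; case: (boolP (i \in F)) => [/FG ->|].
Qed.

Section hilbert_schmidt.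
Context {R : realType} {X : ptopologicalType} {H : hilbert R} {J : choiceType}.
Variables (mu : {measure set (borel X) -> \bar R}) (k : X -> H) (e : J -> H).
Hypothesis kF : normalized_parseval_frame mu k.
Hypothesis e_basis : orthonormal_basis e.
Local Notation m := (fprod k).
Local Notation toep psi := (toeplitz mu k (fun x => (psi x)%:C)).
Implicit Types (F G s : seq J) (psi phi : borel X -> R).

Let e_orth : forall i j, '<e i, e j> = (i == j)%:R.
Proof. by case: e_basis. Qed.

Lemma frame_ip1 x : ip (k x) (k x) = 1.
Proof. by rewrite ip_nrm /nrm (frame_normalized kF) expr1n. Qed.

Definition mass F (x : borel X) : R := \sum_(i <- F) m (e i) (e i) x.

Lemma mass_ge0 F x : 0 <= mass F x.
Proof. by apply: sumr_ge0 => i _; exact: fprod_ge0. Qed.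

(** Bessel's inequality for the unit vector [k x]. *)
Lemma mass_le1 F x : uniq F -> mass F x <= 1.
Proof.
move=> uF; rewrite -(frame_ip1 x); apply: le_trans (bessel e_orth (k x) uF).
rewrite ip_proj//; apply: ler_sum => i _.
by rewrite /fprod mulrC.
Qed.

Lemma measurable_mass F : measurable_fun setT (mass F).
Proof.
by apply: rintegrable_measurable (mu) _ _; apply: rintegrable_sum => i;
  exact: fprod_integrable.
Qed.

Definition hs psi F : R := \sum_(i <- F) ip (toep psi (e i)) (toep psi (e i)).

Lemma mass_integrable psi F : L2 mu psi ->
  rintegrable mu (fun x => psi x ^+ 2 * mass F x).
Proof.
move=> Lpsi; apply: (eq_rintegrable (f := fun x => \sum_(i <- F) psi x ^+ 2 * m (e i) (e i) x)).
  by move=> x; rewrite mulr_sumr.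
by apply: rintegrable_sum => i; exact: sqr_fprod_integrable.
Qed.

(** Sum [defectE] over [F]; what separates the integral of psi^2 mass F from that of psi^2 is the
    tail term. For [sigma] and its eigenvectors the last integrands become (lambda_i - sigma)^2 m (e
    i) (e i). *)
Lemma hs_defectE psi F : L2 mu psi ->
  \int[mu]_x (psi x ^+ 2) - hs psi F =
  \int[mu]_x (psi x ^+ 2 * (1 - mass F x)) +
  \sum_(i <- F) \int[mu]_x m (toep psi (e i) - (psi x)%:C *: e i)
                             (toep psi (e i) - (psi x)%:C *: e i) x.
Proof.
move=> Lpsi; under [X in _ = _ + X]eq_bigr do rewrite -defectE//.
rewrite sumrB -/(hs psi F) -Rintegral_sum => [|i]; last exact: sqr_fprod_integrable.
rewrite (_ : \int[mu]_x (\sum_(i <- F) _) = \int[mu]_x (psi x ^+ 2 * mass F x)).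
  rewrite addrA -RintegralD//; first last.
  - exact: mass_integrable.
  - apply: eq_rintegrable (rintegrableB Lpsi.2 (mass_integrable F Lpsi)) => x.
    by rewrite mulrBr mulr1.
  by congr (_ - _); apply: eq_Rintegral => x _; ring.
by apply: eq_Rintegral => x _; rewrite mulr_sumr.
Qed.

Lemma tail_ge0 psi F : uniq F -> 0 <= \int[mu]_x (psi x ^+ 2 * (1 - mass F x)).
Proof.
move=> uF; apply: Rintegral_ge0 => x _; rewrite mulr_ge0 ?sqr_ge0//.
by rewrite subr_ge0 mass_le1.
Qed.

Lemma tail_le psi F : L2 mu psi ->
  \int[mu]_x (psi x ^+ 2 * (1 - mass F x)) <= \int[mu]_x (psi x ^+ 2) - hs psi F.
Proof.
move=> Lpsi; rewrite hs_defectE// lerDl; apply: sumr_ge0 => i _.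
by apply: Rintegral_ge0 => x _; exact: fprod_ge0.
Qed.

Lemma variance_le psi F : L2 mu psi -> uniq F ->
  \sum_(i <- F) \int[mu]_x m (toep psi (e i) - (psi x)%:C *: e i)
                             (toep psi (e i) - (psi x)%:C *: e i) x <=
  \int[mu]_x (psi x ^+ 2) - hs psi F.
Proof. by move=> Lpsi uF; rewrite hs_defectE// lerDr tail_ge0. Qed.

Lemma hs_le psi F : L2 mu psi -> uniq F -> hs psi F <= \int[mu]_x (psi x ^+ 2).
Proof. by move=> Lpsi uF; rewrite -subr_ge0; apply: le_trans (tail_le F Lpsi); exact: tail_ge0. Qed.

Lemma hs_mono psi F G : uniq F -> uniq G -> {subset F <= G} -> hs psi F <= hs psi G.
Proof.
move=> uF uG FG; rewrite /hs (sum_subset _ uF uG FG) lerDl.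
by apply: sumr_ge0 => i _; exact: ip_ge0.
Qed.

(** Self-adjointness moves the operator from [k x] to each [e i]. *)
Lemma proj_term psi F x : L2 mu psi ->
  ip (toep psi (k x)) (proj e F (k x)) = \sum_(i <- F) m (e i) (toep psi (e i)) x.
Proof.
move=> Lpsi.
rewrite ipC ip_suml; apply: eq_bigr => i _.
rewrite /fprod -(toeplitz_sa kF)// /ip innerZl (innerC (k x) (e i)).
rewrite (innerC (e i) (toep _ _)).
by case: '<e i, k x> => a b; case: '<toep _ _, e i> => c d /=; ring.
Qed.

(** The basis now enters only through the projection of [k x], so the integrand can be followed
    pointwise while [F] varies. *)
Lemma hs_integral psi F : L2 mu psi ->
  hs psi F = \int[mu]_x (psi x * ip (toep psi (k x)) (proj e F (k x))).
Proof.
move=> Lpsi; rewrite /hs; under eq_bigr do rewrite (ip_toeplitz kF)//.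
rewrite -Rintegral_sum => [|i]; last exact: mul_fprod_integrable.
by apply: eq_Rintegral => x _; rewrite -mulr_sumr proj_term.
Qed.

(* [e i] contributes to the limit only if [toep psi (e i) != 0], which happens
   for countably many [i]: this replaces separability of the Hilbert space. *)
Lemma exhaustion psi : L2 mu psi -> exists F : nat -> seq J,
  (forall n, uniq (F n)) /\
  forall x, ip (toep psi (k x)) (proj e (F n) (k x)) @[n --> \oo] -->
    ip (toep psi (k x)) (k x).
Proof.
move=> Lpsi; pose a i := ip (toep psi (e i)) (toep psi (e i)).
have : forall n : nat, exists F, uniq F /\ forall i, n.+1%:R^-1 < a i -> i \in F.
  move=> n; apply: (sum_bounded_large (C := \int[mu]_x (psi x ^+ 2))) => //.
  by move=> G uG; exact: hs_le.
move=> /choice[F FP].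
exists F; split=> [n|x]; first by have [] := FP n.
have [_ e_dense] := e_basis.
apply/cvgrPdist_lt => eps eps0.
pose B := ip (toep psi (k x)) (toep psi (k x)) + 1.
have B0 : 0 < B by rewrite ltr_wpDl ?ip_ge0.
have [s sP] := proj_dense e_orth (k x) e_dense (divr_gt0 (exprn_gt0 2 eps0) B0).
have [N NP] : exists N : nat, forall n i, (N <= n)%N -> i \in s -> a i != 0 -> i \in F n.
  elim: (s) => [|i0 s' [N NP]]; first by exists 0%N.
  have [ai0|ai0] := eqVneq (a i0) 0.
    exists N => n i Nn; rewrite inE => /predU1P[->|/NP]; last exact.
    by rewrite ai0 eqxx.
  have ai_gt0 : 0 < a i0 by rewrite lt_def ai0 ip_ge0.
  have [N' _ hN'] := near_infty_natSinv_lt (PosNum ai_gt0).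
  exists (maxn N N') => n i; rewrite geq_max inE => /andP[Nn Nn'].
  move=> /predU1P[->|/NP]; last exact.
  by move=> _; have [_] := FP n; apply; exact: hN'.
exists N => // n /= Nn; have [uFn _] := FP n.
pose G := undup (s ++ F n).
have uG : uniq G by exact: undup_uniq.
have FG : {subset F n <= G} by move=> i iF; rewrite mem_undup mem_cat iF orbT.
(* Indices of [G] outside [F n] lie in [s] and have [a i = 0], so [toep psi (e i) = 0] and they
   contribute nothing. Passing to [G], which contains [s], makes the choice of [s] applicable. *)
have -> : ip (toep psi (k x)) (proj e (F n) (k x)) =
          ip (toep psi (k x)) (proj e G (k x)).
  rewrite !proj_term// (sum_subset _ uFn uG FG) [X in _ + X]big_seq_cond.
  rewrite [X in _ + X]big1 ?addr0// => i.
  rewrite mem_undup mem_cat => /andP[/orP[iS|->//] iF].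
  have [/ip_eq0 ->|/(NP n i Nn iS)] := eqVneq (a i) 0; last by rewrite (negbTE iF).
  by rewrite fprod_ip ipC ip0l.
rewrite -ipNr -ipDr -(@ltr_pXn2r _ 2) ?nnegrE ?normr_ge0 ?(ltW eps0)//.
rewrite real_normK ?num_real//; apply: le_lt_trans (ip_CS _ _) _.
have sG : {subset s <= G} by move=> i iS; rewrite mem_undup mem_cat iS.
have := sP G uG sG; rewrite ltr_pdivlMr// mulrC; apply: le_lt_trans.
by rewrite ler_wpM2r ?ip_ge0// /B lerDl.
Qed.

End hilbert_schmidt.

(** * Open sets of finite measure *)

Section scaled_measure.
Context {d} {T : measurableType d} {R : realType}.
Variables (m1 m2 : {measure set T -> \bar R}) (c : R).
Hypothesis c0 : 0 < c.
Hypothesis m12 : forall B, measurable B -> m1 B = (c%:E * m2 B)%E.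

Lemma ge0_integral_scaled (D : set T) (f : T -> \bar R) : measurable D ->
  measurable_fun D f -> (forall x, D x -> 0 <= f x)%E ->
  (\int[m1]_(x in D) f x = c%:E * \int[m2]_(x in D) f x)%E.
Proof.
move=> mD mf f0; rewrite -(ge0_integral_mscale m2 mD (NngNum (ltW c0)) mf f0).
by apply: eq_measure_integral => B mB _; rewrite m12.
Qed.

Lemma rintegrable_scaled f : rintegrable m2 f -> rintegrable m1 f.
Proof.
move=> /integrableP[mf fi]; apply/integrableP; split=> //.
rewrite ge0_integral_scaled//; last exact: measurableT_comp.
by rewrite lte_mul_pinfty// lee_fin ltW.
Qed.

Lemma Rintegral_scaled f : rintegrable m2 f ->
  \int[m1]_x f x = c * \int[m2]_x f x.
Proof.
move=> fi; have mf := measurable_int m2 fi.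
rewrite /Rintegral integralE [X in _ = c * fine X]integralE.
rewrite !ge0_integral_scaled//; [|exact: measurable_funeneg|exact: measurable_funepos].
have pf := integrable_pos_fin_num measurableT fi.
have nf := integrable_neg_fin_num measurableT fi.
rewrite -(fineK pf) -(fineK nf) -!EFinM -!EFinB /=.
by rewrite mulrBr.
Qed.

Lemma L2_scaled psi : L2 m2 psi -> L2 m1 psi.
Proof. by case=> mpsi ipsi; split=> //; exact: rintegrable_scaled. Qed.

End scaled_measure.

Section indicators.
Context {d} {T : measurableType d} {R : realType}.
Variable mu : {measure set T -> \bar R}.

Lemma rintegrable_indic (U : set T) : measurable U -> (mu U < +oo)%E ->
  rintegrable mu (\1_U : T -> R).
Proof.
move=> mU Uoo; apply/integrableP; split.
  by apply/measurable_EFinP; exact: measurable_indic.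
under eq_integral do rewrite /= ger0_norm ?ler0n//.
by rewrite integral_indic// setIT.
Qed.

Lemma sqr_indic (U : set T) (x : T) : (\1_U x : R) ^+ 2 = \1_U x.
Proof. by rewrite indicE; case: (_ \in _); rewrite ?expr1n ?expr0n. Qed.

Lemma L2_indic (U : set T) : measurable U -> (mu U < +oo)%E ->
  L2 mu (\1_U : T -> R).
Proof.
move=> mU Uoo; split; first exact: measurable_indic.
apply: eq_rintegrable (rintegrable_indic mU Uoo) => x.
by rewrite sqr_indic.
Qed.

Lemma Rintegral_indic (U : set T) : measurable U ->
  \int[mu]_x (\1_U x : R) = fine (mu U).
Proof. by move=> mU; rewrite /Rintegral integral_indic// setIT. Qed.

End indicators.

(** * Hilbert-Schmidt norms for indicator symbols *)

Section local_trace.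
Context {R : realType} {X : ptopologicalType} {H : hilbert R} {J : choiceType}.
Variables (mu : {measure set (borel X) -> \bar R}) (k : X -> H) (e : J -> H).
Hypothesis kF : normalized_parseval_frame mu k.
Hypothesis e_basis : orthonormal_basis e.
Local Notation m := (fprod k).
Local Notation toep psi := (toeplitz mu k (fun x => (psi x)%:C)).
Variable U : set (borel X).
Hypotheses (mU : measurable U) (Uoo : (mu U < +oo)%E).

(** The Berezin transform of the indicator of [U]: the integral of |<k x, k y>|^2 over y in [U]. *)
Definition local_berezin (x : borel X) : R := \int[mu]_y (\1_U y * m (k x) (k x) y).

Let L2U := L2_indic mU Uoo.

Let indic_m_le f y : `|\1_U y * m f f y| <= m f f y.
Proof.
rewrite ger0_norm ?mulr_ge0 ?fprod_ge0// indicE.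
by case: (_ \in _); rewrite ?mul1r ?mul0r ?fprod_ge0.
Qed.

Lemma toeplitz_indic_le f : ip (toep \1_U f) (toep \1_U f) <= ip f f.
Proof.
apply: le_trans (toeplitz_norm_le kF f L2U) _; rewrite -(Rintegral_fprod kF).
apply: le_Rintegral => //; [exact: sqr_fprod_integrable|exact: fprod_integrable|].
by move=> x _; rewrite sqr_indic; exact: le_trans (ler_norm _) (indic_m_le _ _).
Qed.

Lemma local_berezinE x : local_berezin x = ip (toep \1_U (k x)) (k x).
Proof. by rewrite ip_toeplitz. Qed.

Lemma local_berezin_bounds x : 0 <= local_berezin x <= 1.
Proof.
apply/andP; split.
  by apply: Rintegral_ge0 => y _; rewrite mulr_ge0 ?fprod_ge0.
rewrite -(frame_ip1 kF x) -(Rintegral_fprod kF).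
apply: le_Rintegral => //; [exact: mul_fprod_integrable|exact: fprod_integrable|].
by move=> y _; exact: le_trans (ler_norm _) (indic_m_le _ _).
Qed.

(** The integral of |<k x, k y>|^2 over the whole space is <k x, k x> = 1. This puts the
    localization hypothesis in terms of [local_berezin]. *)
Lemma local_berezin_compl x :
  (\int[mu]_(y in ~` U) (complex.Re (`|'<k x, k y>| ^+ 2))%:E)%E =
  (1 - local_berezin x)%:E.
Proof.
have i1 := mul_fprod_integrable kF (k x) (k x) L2U.
have i2 := fprod_integrable kF (k x) (k x).
rewrite integral_mkcond (_ : _ \_ _ =
  EFin \o (fun y => m (k x) (k x) y - \1_U y * m (k x) (k x) y)).
  rewrite -(frame_ip1 kF x) -(Rintegral_fprod kF) -RintegralB// /Rintegral fineK//.
  by apply: integrable_fin_num => //; exact: rintegrableB.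
apply/funext => y; rewrite patchE -fprod_normE /= indicE in_setC.
by case: (_ \in _); rewrite ?mul1r ?mul0r ?subrr ?subr0.
Qed.

(** Dominated convergence in [hs_integral] along [exhaustion]. The dominating function is the
    indicator of [U], because neither the operator nor the projection increases the norm of the unit
    vector [k x]. *)
Lemma local_trace (eps : R) : 0 < eps ->
  rintegrable mu (fun x => \1_U x * local_berezin x) /\
  exists F : seq J, uniq F /\
    \int[mu]_x (\1_U x * local_berezin x) - eps < hs mu k e \1_U F.
Proof.
move=> eps0; have [F [uF Fcvg]] := exhaustion kF e_basis L2U.
have [|||ilim climit] := @Rintegral_dominated _ _ _ mu
  (fun n x => \1_U x * ip (toep \1_U (k x)) (proj e (F n) (k x)))
  (fun x => \1_U x * local_berezin x) \1_U _ _ (rintegrable_indic mU Uoo).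
- move=> n; apply: rintegrable_measurable (mu) _ _.
  apply: (eq_rintegrable (f := fun x => \sum_(i <- F n) \1_U x * m (e i) (toep \1_U (e i)) x)).
    by move=> x; rewrite proj_term// mulr_sumr.
  by apply: rintegrable_sum => i; exact: mul_fprod_integrable.
- by move=> x; rewrite local_berezinE; apply: cvgM; [exact: cvg_cst|exact: Fcvg].
- move=> n x; rewrite normrM ger0_norm// ler_piMr//.
  rewrite -(@ler_pXn2r _ 2) ?nnegrE// real_normK ?num_real// expr1n.
  apply: le_trans (ip_CS _ _) _; rewrite -[leRHS]mulr1.
  apply: ler_pM; rewrite ?ip_ge0// -(frame_ip1 kF x); first exact: toeplitz_indic_le.
  by apply: bessel; [case: e_basis|exact: uF].
split=> [|{ilim}]; first exact: ilim.
move/cvgrPdist_lt : climit => /(_ _ eps0)[N _ /(_ N (leqnn N))].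
rewrite -(hs_integral e kF)//= ltr_norml => /andP[_ h].
exists (F N); split; first exact: uF.
by move: h; rewrite !ltrBlDr addrC.
Qed.

End local_trace.

(** * Asymptotics of Hilbert-Schmidt norms *)

Section asymptotics.
Context {R : realType} {X : ptopologicalType} {A : set R}.
Context {H : R -> hilbert R} {J : R -> choiceType}.
Variables (k : forall alpha, X -> H alpha) (e : forall alpha, J alpha -> H alpha).
Variables (nua : R -> {measure set (borel X) -> \bar R}) (c : R -> R).
Variable nu : {measure set (borel X) -> \bar R}.
Hypothesis k_frame : forall alpha, A alpha ->
  normalized_parseval_frame (nua alpha) (k alpha).
Hypothesis e_basis : forall alpha, A alpha -> orthonormal_basis (@e alpha).
Hypothesis c_gt0 : forall alpha, A alpha -> 0 < c alpha.
Hypothesis nuaE : forall alpha, A alpha -> forall B : set (borel X),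
  measurable B -> nua alpha B = ((c alpha)%:E * nu B)%E.
Implicit Types psi phi : borel X -> R.

Let HS alpha psi (F : seq (J alpha)) : R := hs (nua alpha) (k alpha) (@e alpha) psi F.

Lemma L2_nua alpha psi : A alpha -> L2 nu psi -> L2 (nua alpha) psi.
Proof. by move=> Aa; exact: L2_scaled (c_gt0 Aa) (nuaE Aa) psi. Qed.

Lemma Rintegral_nua alpha f : A alpha -> rintegrable nu f ->
  \int[nua alpha]_x f x = c alpha * \int[nu]_x f x.
Proof. by move=> Aa; exact: Rintegral_scaled (c_gt0 Aa) (nuaE Aa) f. Qed.

Lemma nuE alpha : A alpha -> forall B : set (borel X),
  measurable B -> nu B = (((c alpha)^-1)%:E * nua alpha B)%E.
Proof.
move=> Aa B mB; rewrite nuaE// muleA -EFinM mulVf ?mul1e//.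
by rewrite gt_eqF// c_gt0.
Qed.

Lemma rintegrable_nu alpha f : A alpha -> rintegrable (nua alpha) f -> rintegrable nu f.
Proof.
move=> Aa; apply: rintegrable_scaled (nuE Aa) f.
by rewrite invr_gt0 c_gt0.
Qed.

(* Since [hs psi F <= \int psi ^+ 2] always holds, this says that
   c(alpha)^-1 |T_psi|_HS^2 tends to the square of the L2 norm of psi, the
   Hilbert-Schmidt norm being approached along finite sets of basis vectors. *)
Definition hs_full psi := forall eps, 0 < eps -> exists M : R,
  forall alpha, A alpha -> M < alpha -> exists F : seq (J alpha), uniq F /\
  \int[nua alpha]_x (psi x ^+ 2) - HS psi F <= eps * c alpha.

(** By monotonicity of [hs] the estimate survives enlarging [F], so finite sets found for different
    symbols can be merged. *)
Lemma hs_fullP psi eps : L2 nu psi -> hs_full psi -> 0 < eps -> exists M : R,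
  forall alpha, A alpha -> M < alpha -> exists F : seq (J alpha), uniq F /\
  forall G : seq (J alpha), uniq G -> {subset F <= G} ->
  \int[nua alpha]_x (psi x ^+ 2) - HS psi G <= eps * c alpha.
Proof.
move=> Lpsi gpsi eps0; have [M hM] := gpsi _ eps0; exists M => alpha Aa Ma.
have [F [uF hF]] := hM _ Aa Ma; exists F; split=> // G uG FG.
by apply: le_trans hF; rewrite lerD2l lerN2 /HS hs_mono.
Qed.

Lemma HS_parallelogram alpha psi phi (F : seq (J alpha)) : A alpha ->
  L2 nu psi -> L2 nu phi ->
  HS (fun x => psi x + phi x) F + HS (fun x => psi x - phi x) F =
  2 * HS psi F + 2 * HS phi F.
Proof.
move=> Aa /(L2_nua Aa) Lpsi /(L2_nua Aa) Lphi; have kF := k_frame Aa.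
rewrite /HS /hs ![in RHS]mulr_sumr -!big_split /=; apply: eq_bigr => i _.
by rewrite (toeplitzD kF)// (toeplitzB kF)// parallelogram.
Qed.

(** The squared L2 norm and [HS] both obey the parallelogram law, hence so does their difference;
    its value at psi - phi is nonnegative by [hs_le] and is dropped. *)
Lemma defectD alpha psi phi (F : seq (J alpha)) : A alpha -> uniq F ->
  L2 nu psi -> L2 nu phi ->
  \int[nua alpha]_x ((psi x + phi x) ^+ 2) - HS (fun x => psi x + phi x) F <=
  2 * (\int[nua alpha]_x (psi x ^+ 2) - HS psi F) +
  2 * (\int[nua alpha]_x (phi x ^+ 2) - HS phi F).
Proof.
move=> Aa uF Lpsi Lphi; have := HS_parallelogram F Aa Lpsi Lphi.
have Apsi := L2_nua Aa Lpsi; have Aphi := L2_nua Aa Lphi.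
have /(_ uF) := hs_le (F := F) (k_frame Aa) (e_basis Aa) (L2B Apsi Aphi).
have : \int[nua alpha]_x ((psi x + phi x) ^+ 2) + \int[nua alpha]_x ((psi x - phi x) ^+ 2) =
  2 * \int[nua alpha]_x (psi x ^+ 2) + 2 * \int[nua alpha]_x (phi x ^+ 2).
  rewrite -RintegralD//; [|exact: (L2D Apsi Aphi).2|exact: (L2B Apsi Aphi).2].
  rewrite -!RintegralZl//; [|exact: Aphi.2|exact: Apsi.2].
  rewrite -RintegralD//; [|exact: rintegrableZ Apsi.2|exact: rintegrableZ Aphi.2].
  by apply: eq_Rintegral => x _; ring.
rewrite -/(HS _ F).
move: (\int[_]_x ((psi x + phi x) ^+ 2)) (\int[_]_x ((psi x - phi x) ^+ 2)).
move: (\int[_]_x (psi x ^+ 2)) (\int[_]_x (phi x ^+ 2)).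
move: (HS _ F) (HS _ F) (HS psi F) (HS phi F) => a b a' b' i i' j j'; lra.
Qed.

Lemma hs_fullD psi phi : L2 nu psi -> L2 nu phi -> hs_full psi -> hs_full phi ->
  hs_full (fun x => psi x + phi x).
Proof.
move=> Lpsi Lphi gpsi gphi eps eps0.
have e4 : 0 < eps / 4 by rewrite divr_gt0.
have [M1 hM1] := hs_fullP Lpsi gpsi e4; have [M2 hM2] := hs_fullP Lphi gphi e4.
exists (Num.max M1 M2) => alpha Aa; rewrite gt_max => /andP[Ma1 Ma2].
have [F1 [uF1 hF1]] := hM1 _ Aa Ma1; have [F2 [uF2 hF2]] := hM2 _ Aa Ma2.
pose F := undup (F1 ++ F2).
have uF : uniq F by exact: undup_uniq.
exists F; split=> //.
apply: le_trans (defectD Aa uF Lpsi Lphi) _.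
have FF1 : {subset F1 <= F} by move=> i iF; rewrite mem_undup mem_cat iF.
have FF2 : {subset F2 <= F} by move=> i iF; rewrite mem_undup mem_cat iF orbT.
have arith (a b ca : R) :
  a <= eps / 4 * ca -> b <= eps / 4 * ca -> 2 * a + 2 * b <= eps * ca by lra.
exact: arith (hF1 _ uF FF1) (hF2 _ uF FF2).
Qed.

Lemma hs_fullZ a psi : L2 nu psi -> hs_full psi -> hs_full (fun x => a * psi x).
Proof.
move=> Lpsi gpsi eps eps0.
have [|M hM] := gpsi (eps / (a ^+ 2 + 1)); first by rewrite divr_gt0// ltr_wpDl// sqr_ge0.
exists M => alpha Aa Ma; have [F [uF hF]] := hM _ Aa Ma; exists F; split=> //.
have Apsi := L2_nua Aa Lpsi.
have -> : HS (fun x => a * psi x) F = a ^+ 2 * HS psi F.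
  rewrite /HS /hs mulr_sumr; apply: eq_bigr => i _.
  by rewrite (toeplitzZ (k_frame Aa))// ipZl ipZr mulrA -expr2.
under eq_Rintegral do rewrite exprMn.
rewrite RintegralZl//; last exact: Apsi.2.
rewrite -mulrBr; apply: le_trans (_ : a ^+ 2 * (eps / (a ^+ 2 + 1) * c alpha) <= _).
  by rewrite ler_wpM2l// sqr_ge0.
have a1 : 0 < a ^+ 2 + 1 by rewrite ltr_wpDl// sqr_ge0.
rewrite mulrA ler_wpM2r ?(ltW (c_gt0 Aa))// mulrA ler_pdivrMr// mulrC.
by rewrite ler_wpM2l ?(ltW eps0)// lerDl.
Qed.

Lemma hs_full0 : hs_full (fun=> 0).
Proof.
move=> eps eps0; exists 0 => alpha Aa _; exists [::]; split=> //.
rewrite /HS /hs big_nil subr0 expr0n /= Rintegral_cst// mul0r.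
by rewrite mulr_ge0// ltW// c_gt0.
Qed.

Lemma L2_0 : L2 nu (fun=> 0).
Proof.
split; first exact: measurable_cst.
by apply: eq_integrable (integrable0 nu setT) => // x _ /=; rewrite expr0n.
Qed.

Lemma hs_full_sum (I : Type) (s : seq I) (f : I -> borel X -> R) :
  (forall i, L2 nu (f i) /\ hs_full (f i)) ->
  L2 nu (fun x => \sum_(i <- s) f i x) /\ hs_full (fun x => \sum_(i <- s) f i x).
Proof.
move=> fP; elim: s => [|i s [Ls gs]].
  under eq_fun do rewrite big_nil; split; [exact: L2_0|exact: hs_full0].
under eq_fun do rewrite big_cons.
have [Li gi] := fP i; split; first exact: L2D.
exact: (hs_fullD Li Ls gi gs).
Qed.

(** Apply [defectD] to phi + (psi - phi): the defect of psi - phi is at most its squared L2 norm,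
    which is c(alpha) times a quantity small uniformly in alpha. *)
Lemma hs_full_approx psi : L2 nu psi ->
  (forall d, 0 < d -> exists phi, [/\ L2 nu phi, hs_full phi &
     \int[nu]_x ((psi x - phi x) ^+ 2) <= d]) ->
  hs_full psi.
Proof.
move=> Lpsi h eps eps0; have e4 : 0 < eps / 4 by rewrite divr_gt0.
have [phi [Lphi gphi dphi]] := h _ e4.
have [M hM] := gphi _ e4; exists M => alpha Aa Ma.
have [F [uF hF]] := hM _ Aa Ma; exists F; split=> //.
have := defectD Aa uF Lphi (L2B Lpsi Lphi).
have -> : (fun x => phi x + (psi x - phi x)) = psi by apply/funext => x; ring.
rewrite (_ : \int[_]_x ((_ + _) ^+ 2) = \int[nua alpha]_x (psi x ^+ 2)); last first.
  by apply: eq_Rintegral => x _; ring.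
move/le_trans; apply.
have HS0 : 0 <= HS (fun x => psi x - phi x) F by apply: sumr_ge0 => i _; exact: ip_ge0.
rewrite [\int[_]_x ((_ - _) ^+ 2)]Rintegral_nua//; last exact: (L2B Lpsi Lphi).2.
have arith (a b i ca : R) : 0 <= b -> a <= eps / 4 * ca ->
  ca * i <= ca * (eps / 4) -> 2 * a + 2 * (ca * i - b) <= eps * ca by lra.
exact: arith HS0 hF (ler_wpM2l (ltW (c_gt0 Aa)) dphi).
Qed.

Hypothesis k_localized : forall (x : X) (U : set (borel X)),
  nbhs x (U : set X) -> measurable U ->
  (\int[nua alpha]_(y in ~` U)
     (complex.Re (`|'<k alpha x, k alpha y>| ^+ 2))%:E)%E
    @[alpha --> within A (pinfty_nbhs R)] --> 0%E.

(** Dominated convergence is applied along sequences, so limits in alpha are tested on sequences in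
    [A] tending to infinity. *)
Lemma cvg_within_pinfty (al : nat -> R) : (forall n, A (al n)) ->
  (forall n, n%:R < al n) -> al n @[n --> \oo] --> within A (pinfty_nbhs R).
Proof.
move=> Aal al_gt P [M [_ MP]].
have [N _ hN] := nbhs_infty_ger M.
exists N => // n /= Nn; apply: MP (Aal n).
exact: le_lt_trans (hN n Nn) (al_gt n).
Qed.

(** A failure gives a sequence of parameters at which every finite set has defect above eps c. As
    [U] is a neighborhood of each of its points, localization sends [local_berezin] to 1 on [U];
    dominated convergence and [local_trace] then produce a finite set with smaller defect. *)
Lemma hs_full_open (U : set (borel X)) : open (U : set X) -> (nu U < +oo)%E ->
  hs_full \1_U.
Proof.
move=> oU Uoo; have mU : measurable U by exact: sub_sigma_algebra.
have Uaoo alpha : A alpha -> (nua alpha U < +oo)%E.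
  move=> Aa; rewrite nuaE// lte_mul_pinfty//.
  by rewrite lee_fin ltW// c_gt0.
move=> eps eps0; apply: contrapT => /forallNP bad.
have : forall n : nat, exists alpha, [/\ A alpha, n%:R < alpha &
    forall F : seq (J alpha), uniq F -> eps * c alpha <
      \int[nua alpha]_x ((\1_U x : R) ^+ 2) - HS \1_U F].
  move=> n; have /existsNP[al /not_implyP[Aal /not_implyP[nal /forallNP noF]]] := bad n%:R.
  exists al; split=> // F uF; rewrite ltNge; apply/negP => h.
  by apply: (noF F); split.
move=> /choice[al alP].
have Aal n : A (al n) by case: (alP n).
have al_gt n : n%:R < al n by case: (alP n).
pose u n x := local_berezin (nua (al n)) (k (al n)) U x.
have iu n : rintegrable nu (fun x => \1_U x * u n x).
  apply: (rintegrable_nu (Aal n)).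
  by have [] := local_trace (k_frame (Aal n)) (e_basis (Aal n)) mU (Uaoo _ (Aal n)) ltr01.
have u_cvg x : \1_U x * u n x @[n --> \oo] --> (\1_U x : R).
  rewrite indicE; have [xU|xU] := boolP (x \in U); last first.
    by under eq_fun do rewrite mul0r; exact: cvg_cst.
  under eq_fun do rewrite mul1r.
  have nU : nbhs x (U : set X) by apply: open_nbhs_nbhs; split=> //; exact/set_mem.
  have := cvg_comp _ _ (cvg_within_pinfty Aal al_gt) (k_localized nU mU).
  rewrite (_ : _ \o _ = EFin \o (fun n => 1 - u n x)); last first.
    by apply/funext => n; exact: (local_berezin_compl (k_frame (Aal n)) mU (Uaoo _ (Aal n)) x).
  move=> /fine_cvg /= u1.
  have : (fun n => 1 - (1 - u n x)) @ \oo --> (1 : R).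
    by rewrite -[X in _ --> X]subr0; apply: cvgB => //; exact: cvg_cst.
  have -> // : (fun n => 1 - (1 - u n x)) = fun n => u n x.
  by apply/funext => n; rewrite opprB addrC subrK.
have [||_ climit] := Rintegral_dominated (f_ := fun n x => \1_U x * u n x)
   (f := \1_U) _ u_cvg (rintegrable_indic mU Uoo).
- by move=> n; exact: rintegrable_measurable (iu n).
- move=> n x; have /andP[u0 u1] := local_berezin_bounds (k_frame (Aal n)) mU (Uaoo _ (Aal n)) x.
  by rewrite normrM ger0_norm// ler_piMr// ger0_norm.
have e2 : 0 < eps / 2 by rewrite divr_gt0.
move/cvgrPdist_lt : climit => /(_ _ e2)[N _ /(_ N (leqnn N))] /=.
rewrite ltr_norml => /andP[_ hN].
have [AN _ badN] := alP N; have cN := c_gt0 AN.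
have [_ [F [uF]]] := local_trace (k_frame AN) (e_basis AN) mU (Uaoo _ AN)
  (mulr_gt0 cN e2).
rewrite (Rintegral_nua AN (iu N)) -/(HS _ F).
have := badN F uF; under eq_Rintegral do rewrite sqr_indic.
rewrite (Rintegral_nua AN (rintegrable_indic mU Uoo)).
move: hN; set I := \int[nu]_x \1_U x; set I' := \int[nu]_x (_ * _) => hN h2 h3.
have : c (al N) * (I - I') < c (al N) * (eps / 2) by rewrite ltr_pM2l.
by move: h2 h3; rewrite mulrBr [eps * _]mulrC; lra.
Qed.

Hypothesis nu_outer : forall B : set (borel X), measurable B ->
  nu B = ereal_inf [set nu U | U in [set U : set X | open U /\ B `<=` U]].

(** Outer regularity gives an open [U] containing [B] with nu(U \ B) <= d, and this measure is the
    squared L2 distance of the two indicators. *)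
Lemma hs_full_indic (B : set (borel X)) : measurable B -> (nu B < +oo)%E ->
  hs_full \1_B.
Proof.
move=> mB Boo; apply: (hs_full_approx (L2_indic mB Boo)).
move=> d d0.
have Bfin : nu B \is a fin_num by rewrite ge0_fin_numE.
have [_ [U [oU BU] <-]] : exists2 y, [set nu U | U in [set U : set X | open U /\ B `<=` U]] y &
    (y < nu B + d%:E)%E.
  by rewrite {1}nu_outer//; apply: lb_ereal_inf_adherent; rewrite -?nu_outer.
move=> Ud; have mU : measurable (U : set (borel X)) by exact: sub_sigma_algebra.
have Uoo : (nu U < +oo)%E by apply: lt_le_trans Ud _; rewrite leey.
exists \1_U; split; [exact: L2_indic|exact: hs_full_open|].
have mUB : measurable (U `\` B : set (borel X)) by exact: measurableD.
have -> : \int[nu]_x ((\1_B x - \1_U x : R) ^+ 2) = \int[nu]_x (\1_(U `\` B) x : R).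
  apply: eq_Rintegral => x _; rewrite !indicE in_setD.
  have [xB|xB] := boolP (x \in B).
    by rewrite (mem_set (BU _ (set_mem xB)))/= subrr expr0n.
  by rewrite sub0r sqrrN andbT; case: (_ \in _); rewrite ?expr1n ?expr0n.
rewrite Rintegral_indic// -lee_fin fineK; last first.
  by rewrite ge0_fin_numE//; apply: le_lt_trans Uoo; apply: le_measure; rewrite ?inE.
rewrite measureD// (_ : U `&` B = B); last exact/setIidPr.
by rewrite leeBlDr// addeC ltW// .
Qed.

Lemma hs_full_simple (f : {nnsfun (borel X) >-> R}) : L2 nu f -> hs_full f.
Proof.
move=> [mf if2].
pose s := finmap.enum_fset (fset_set (range f)).
pose g (y : R) : borel X -> R := fun x => y * \1_(f @^-1` [set y]) x.
have -> : (f : borel X -> R) = fun x => \sum_(y <- s) g y x.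
  apply/funext => x; rewrite [LHS]fimfunE fsbig_finite//.
apply: (hs_full_sum s (f := g) _).2 => y.
(* The zero level set may have infinite measure, but its term in the sum vanishes. *)
have [->|y0] := eqVneq y 0.
  have -> : g 0 = fun=> 0 by apply/funext => x; rewrite /g mul0r.
  by split; [exact: L2_0|exact: hs_full0].
have mfy : measurable (f @^-1` [set y] : set (borel X)) by exact: measurable_funPTI.
(* Chebyshev: the indicator of this level set is at most f^2 / y^2. *)
have foo : (nu (f @^-1` [set y]) < +oo)%E.
  have : rintegrable nu (\1_(f @^-1` [set y]) : borel X -> R).
    apply: (rintegrable_le (g := fun x => (y ^+ 2)^-1 * f x ^+ 2)).
    - exact: measurable_indic.
    - move=> x; rewrite ger0_norm// indicE.
      have [/set_mem/= ->|_] := boolP (x \in _).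
        by rewrite mulVf ?lexx// sqrf_eq0.
      by apply: mulr_ge0; [rewrite invr_ge0 sqr_ge0|exact: sqr_ge0].
    - exact: rintegrableZ.
  move=> /(integrable_lty measurableT) /=.
  by rewrite integral_indic// setIT.
have Lfy := L2_indic mfy foo.
split; first exact: L2Z.
exact: hs_fullZ (hs_full_indic mfy foo).
Qed.

(** Increasing simple functions below psi converge to it in L2, since psi^2 dominates the squared
    differences. *)
Lemma hs_full_nonneg psi : (forall x, 0 <= psi x) -> L2 nu psi -> hs_full psi.
Proof.
move=> psi0 Lpsi; have [mpsi ipsi] := Lpsi.
apply: (hs_full_approx Lpsi) => d d0.
have mE : measurable_fun setT (EFin \o psi) by exact/measurable_EFinP.
pose f_ := nnsfun_approx measurableT mE.
have f_cvg x : f_ n x @[n --> \oo] --> psi x.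
  have pE0 y : [set: borel X] y -> (0 <= (EFin \o psi) y)%E by rewrite /= lee_fin.
  exact: fine_cvg (cvg_nnsfun_approx measurableT mE pE0 I).
have f_le n x : f_ n x <= psi x.
  have fc := f_cvg x; rewrite -(cvg_lim _ fc)//.
  apply: (nondecreasing_cvgn_le (u_ := fun n => f_ n x)); last by apply/cvg_ex; exists (psi x).
  by move=> i j ij; have /lefP := nd_nnsfun_approx measurableT mE ij; exact.
have L2f n : L2 nu (f_ n).
  split => //; apply: (rintegrable_le (g := fun x => psi x ^+ 2)) => //.
  - by apply: measurable_funX.
  - by move=> x; rewrite ger0_norm ?sqr_ge0//; apply: lerXn2r; rewrite ?nnegrE.
have [|||_ climit] := Rintegral_dominated (mu := nu)
   (f_ := fun n x => (psi x - f_ n x) ^+ 2) (f := fun=> 0) _ _ ipsi.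
- by move=> n; exact: (rintegrable_measurable (L2B Lpsi (L2f n)).2).
- move=> x; have d_cvg : psi x - f_ n x @[n --> \oo] --> (0 : R).
    by rewrite -(subrr (psi x)); apply: cvgB; [exact: cvg_cst|exact: f_cvg].
  by rewrite -[X in _ --> X](mulr0 0); exact: (cvgM d_cvg d_cvg).
- move=> n x; rewrite ger0_norm ?sqr_ge0//.
  by apply: lerXn2r; rewrite ?nnegrE ?subr_ge0// gerBl.
move/cvgrPdist_lt : climit => /(_ _ d0)[N _ /(_ N (leqnn N))] /=.
rewrite Rintegral_cst// mul0r sub0r normrN => /ltr_normlW hN.
by exists (f_ N); split; [exact: L2f|exact: hs_full_simple|exact: ltW].
Qed.

Lemma hs_full_L2 psi : L2 nu psi -> hs_full psi.
Proof.
move=> Lpsi; have [mpsi ipsi] := Lpsi.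
have Lmax phi : measurable_fun setT phi -> (forall x, phi x ^+ 2 = psi x ^+ 2) ->
    L2 nu (fun x => Num.max (phi x) 0).
  move=> mphi phiE; split; first exact: measurable_maxr.
  apply: (rintegrable_le (g := fun x => psi x ^+ 2)) => //.
    by apply: measurable_funX; exact: measurable_maxr.
  move=> x; rewrite ger0_norm ?sqr_ge0// -phiE.
  by case: (lerP (phi x) 0) => _ //; rewrite expr0n sqr_ge0.
have L1 := Lmax psi mpsi (fun=> erefl).
have sqrE x : (-1 * psi x) ^+ 2 = psi x ^+ 2 by rewrite mulN1r sqrrN.
have L2' := Lmax _ (L2Z (-1) Lpsi).1 sqrE.
have -> : psi = fun x => Num.max (psi x) 0 + -1 * Num.max (-1 * psi x) 0.
  by apply/funext => x; rewrite mulN1r /Num.max; case: ifP; case: ifP; lra.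
apply: hs_fullD; [exact: L1|exact: L2Z L2'| |].
  by apply: hs_full_nonneg => // x; rewrite le_max lexx orbT.
apply: hs_fullZ => //.
by apply: hs_full_nonneg => // x; rewrite le_max lexx orbT.
Qed.

End asymptotics.

(** * Counting eigenvalues *)

Section weighted_escape.
Context {R : realType} {X : ptopologicalType} {H : hilbert R} {J : choiceType}.
Variables (mu : {measure set (borel X) -> \bar R}) (k : X -> H) (e : J -> H).
Hypothesis kF : normalized_parseval_frame mu k.
Hypothesis e_basis : orthonormal_basis e.
Local Notation m := (fprod k).
Local Notation toep psi := (toeplitz mu k (fun x => (psi x)%:C)).
Variables (sigma : borel X -> R) (lambda : J -> R).
Hypothesis sigmaL2 : L2 mu sigma.
Hypothesis eigen : forall j, toep sigma (e j) = (lambda j)%:C *: e j.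
Variables (eta : borel X -> R) (t : R).
Hypothesis eta_ge0 : forall x, 0 <= eta x.
Hypothesis eta_int : rintegrable mu eta.

(* [trunc n] increases to [eta] off the level set [sigma = t], and it makes
   Chebyshev's inequality applicable: if t lies between lambda and sigma x, then
   trunc n x <= n (lambda - sigma x)^2. *)
Definition trunc (n : nat) (x : borel X) : R :=
  Num.min (eta x) (n%:R * (sigma x - t) ^+ 2).

Lemma measurable_trunc n : measurable_fun setT (trunc n).
Proof.
have meta := rintegrable_measurable eta_int.
apply: measurable_minr => //; apply: measurable_funM => //.
by apply: measurable_funX; apply: measurable_funB => //; case: sigmaL2.
Qed.

Lemma trunc_ge0 n x : 0 <= trunc n x.
Proof. by rewrite le_min eta_ge0; apply: mulr_ge0 (sqr_ge0 _). Qed.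

Lemma trunc_le n x : trunc n x <= eta x.
Proof. by rewrite ge_min lexx. Qed.

Lemma trunc_integrable n : rintegrable mu (trunc n).
Proof.
apply: (rintegrable_le (g := eta)) => // [|x]; first exact: measurable_trunc.
by rewrite ger0_norm ?trunc_ge0 ?trunc_le.
Qed.

Lemma weight_integrable F (E : set (borel X)) : measurable E -> uniq F ->
  rintegrable mu (fun x => eta x * \1_E x * mass k e F x).
Proof.
move=> mE uF; apply: (rintegrable_le (g := eta)) => //.
  apply: measurable_funM; last by apply: (measurable_mass (mu := mu)).
  apply: measurable_funM; last exact: measurable_indic.
  exact: rintegrable_measurable eta_int.
move=> x; rewrite ger0_norm; last by apply: mulr_ge0 (mass_ge0 _ _ _ _); exact: mulr_ge0.
rewrite -mulrA ler_piMr// mulr_ile1 ?mass_ge0 ?(mass_le1 kF e_basis)//.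
Qed.

(** Split eta into eta - trunc n and trunc n. The first part is controlled by mass <= 1; on [E] the
    second is at most n (lambda_j - sigma)^2 for each j in [F], and [variance_le] bounds the
    resulting sum. The larger set [G] is there to make the defect small. *)
Lemma weighted_escape n F G (E : set (borel X)) : measurable E ->
  uniq F -> uniq G -> {subset F <= G} ->
  (forall j x, j \in F -> E x -> (sigma x - t) ^+ 2 <= (lambda j - sigma x) ^+ 2) ->
  \int[mu]_x (eta x * \1_E x * mass k e F x) <=
  \int[mu]_x (eta x - trunc n x) +
  n%:R * (\int[mu]_x (sigma x ^+ 2) - hs mu k e sigma G).
Proof.
move=> mE uF uG FG far.
pose v j x := m (toep sigma (e j) - (sigma x)%:C *: e j)
                (toep sigma (e j) - (sigma x)%:C *: e j) x.
have vE j x : v j x = (lambda j - sigma x) ^+ 2 * m (e j) (e j) x.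
  by rewrite /v eigen !(fprodDl, fprodDr, fprodNl, fprodNr, fprodZl, fprodZr); ring.
have iv j : rintegrable mu (v j) by exact: defect_integrable.
have isum := rintegrableZ n%:R (rintegrable_sum F iv).
have ieta := rintegrableB eta_int (trunc_integrable n).
have var : \sum_(i <- F) \int[mu]_x v i x <=
    \int[mu]_x (sigma x ^+ 2) - hs mu k e sigma G.
  apply: le_trans (variance_le kF e_basis sigmaL2 uG).
  rewrite [leRHS](sum_subset _ uF uG FG) lerDl; apply: sumr_ge0 => i _.
  by apply: Rintegral_ge0 => x _; exact: fprod_ge0.
apply: le_trans (lerD (lexx _) (ler_wpM2l (ler0n _ n) var)).
rewrite -Rintegral_sum// -RintegralZl//; last exact: rintegrable_sum.
rewrite -RintegralD//; apply: le_Rintegral => //.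
- exact: weight_integrable.
- exact: rintegrableD.
move=> x _; rewrite indicE.
have v0 : 0 <= n%:R * \sum_(i <- F) v i x.
  by apply: mulr_ge0 => //; apply: sumr_ge0 => i _; exact: fprod_ge0.
have mass1 := mass_le1 kF e_basis x uF; have mass0 := mass_ge0 k e F x.
have d0 : 0 <= eta x - trunc n x by rewrite subr_ge0 trunc_le.
have [xE|_] := boolP (x \in E); last by rewrite /= mulr0 mul0r addr_ge0.
rewrite /= mulr1 -{1}(subrK (trunc n x) (eta x)) mulrDl lerD//.
  by rewrite ler_piMr.
rewrite /mass !mulr_sumr big_seq [leRHS]big_seq; apply: ler_sum => j jF.
rewrite vE mulrA ler_wpM2r ?fprod_ge0//.
apply: (@le_trans _ _ (n%:R * (sigma x - t) ^+ 2)); first by rewrite ge_min lexx orbT.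
by rewrite ler_wpM2l// far//; exact/set_mem.
Qed.

End weighted_escape.

Lemma Rintegral_null d (T : measurableType d) (R : realType)
    (mu : {measure set T -> \bar R}) (f : T -> R) (N : set T) :
  measurable_fun setT f -> measurable N -> mu N = 0%E ->
  \int[mu]_x (f x * \1_N x) = 0.
Proof.
move=> mf mN N0; rewrite /Rintegral.
have -> : (\int[mu]_x (f x * \1_N x)%:E = \int[mu]_(x in N) (f x)%:E)%E.
  rewrite [RHS]integral_mkcond; apply: eq_integral => x _.
  by rewrite patchE indicE; case: (_ \in _); rewrite ?mulr1 ?mulr0.
rewrite null_set_integral//.
by apply/measurable_EFinP; apply: measurable_funS mf.
Qed.

Section trunc_cvg.
Context {R : realType} {X : ptopologicalType}.
Variables (nu : {measure set (borel X) -> \bar R}) (sigma eta : borel X -> R) (t : R).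
Hypothesis sigmaL2 : L2 nu sigma.
Hypothesis eta_ge0 : forall x, 0 <= eta x.
Hypothesis eta_int : rintegrable nu eta.
Hypothesis sigma_t : nu [set x | sigma x = t] = 0%E.

Lemma measurable_level : measurable ([set x | sigma x = t] : set (borel X)).
Proof.
have [msigma _] := sigmaL2.
rewrite -[X in measurable X]setTI (_ : [set x | _] = sigma @^-1` [set t])//.
exact: msigma.
Qed.

(** The difference decreases pointwise to eta restricted to the level set sigma = t, which is null;
    this is where that assumption enters. *)
Lemma trunc_approx (eps : R) : 0 < eps -> exists n : nat,
  \int[nu]_x (eta x - trunc sigma eta t n x) < eps.
Proof.
move=> eps0.
have meta := rintegrable_measurable eta_int.
have [||||_ climit] := @Rintegral_dominated _ _ _ nu
   (fun n x => eta x - trunc sigma eta t n x)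
   (fun x => eta x * \1_[set x | sigma x = t] x) eta.
- by move=> n; apply: measurable_funB => //; exact: (measurable_trunc (mu := nu)).
- move=> x; rewrite indicE; have [/set_mem/= xt|/negP xt] := boolP (x \in _).
    rewrite mulr1 (_ : (fun n => _) = fun=> eta x); first exact: cvg_cst.
    apply/funext => n; rewrite /trunc xt subrr expr0n mulr0 /= min_r// ?subr0//.
  rewrite mulr0; have d0 : 0 < (sigma x - t) ^+ 2.
    rewrite lt_def sqr_ge0 andbT sqrf_eq0 subr_eq0; apply/eqP => st.
    by apply: xt; rewrite inE.
  apply: cvg_near_cst; have [N _ hN] := nbhs_infty_ger (eta x / (sigma x - t) ^+ 2).
  exists N => // n /= /hN /=; rewrite ler_pdivrMr// => h.
  by rewrite /trunc min_l// subrr.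
- exact: eta_int.
- move=> n x; rewrite ger0_norm ?subr_ge0 ?trunc_le// gerBl.
  exact: trunc_ge0.
move: climit; rewrite Rintegral_null//; last exact: measurable_level.
move/cvgrPdist_lt => /(_ _ eps0)[N _ /(_ N (leqnn N))] /=.
by rewrite sub0r normrN => /ltr_normlW; exists N.
Qed.

End trunc_cvg.

Lemma measurable_above {R : realType} {X : ptopologicalType}
    (nu : {measure set (borel X) -> \bar R}) (sigma : borel X -> R) (t : R) :
  L2 nu sigma -> measurable ([set x | t < sigma x] : set (borel X)).
Proof.
move=> [msigma _].
rewrite -[X in measurable X]setTI (_ : [set x | _] = sigma @^-1` `]t, +oo[%classic).
  exact: msigma.
by apply/funext => x; rewrite /= in_itv /= andbT.
Qed.

(** * Upper and lower bounds for the weighted eigenvalue sums *)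

Section counting.
Context {R : realType} {X : ptopologicalType} {A : set R}.
Context {H : R -> hilbert R} {J : R -> choiceType}.
Variables (k : forall alpha, X -> H alpha) (e : forall alpha, J alpha -> H alpha).
Variables (nua : R -> {measure set (borel X) -> \bar R}) (c : R -> R).
Variable nu : {measure set (borel X) -> \bar R}.
Hypothesis k_frame : forall alpha, A alpha ->
  normalized_parseval_frame (nua alpha) (k alpha).
Hypothesis e_basis : forall alpha, A alpha -> orthonormal_basis (@e alpha).
Hypothesis c_gt0 : forall alpha, A alpha -> 0 < c alpha.
Hypothesis nuaE : forall alpha, A alpha -> forall B : set (borel X),
  measurable B -> nua alpha B = ((c alpha)%:E * nu B)%E.
Hypothesis full : forall psi, L2 nu psi -> @hs_full R X A H J k e nua c psi.
Variables (sigma eta : borel X -> R) (t : R) (lambda : forall alpha, J alpha -> R).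
Hypothesis sigmaL2 : L2 nu sigma.
Hypothesis eta_ge0 : forall x, 0 <= eta x.
Hypothesis eta_int : rintegrable nu eta.
Hypothesis sigma_t : nu [set x | sigma x = t] = 0%E.
Hypothesis eigen : forall alpha, A alpha -> forall j,
  toeplitz (nua alpha) (k alpha) (fun x => (sigma x)%:C) (e j) =
  (@lambda alpha j)%:C *: e j.

Local Notation mass_ F := (mass (k _) (@e _) F).

Lemma weight_int_nu alpha F (E : set (borel X)) : A alpha -> measurable E -> uniq F ->
  rintegrable nu (fun x => eta x * \1_E x * mass (k alpha) (@e alpha) F x).
Proof.
move=> Aa mE uF; apply: (rintegrable_nu c_gt0 nuaE Aa).
apply: (weight_integrable (k_frame Aa) (e_basis Aa) eta_ge0) => //.
exact: rintegrable_scaled (c_gt0 Aa) (nuaE Aa) _ eta_int.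
Qed.

(** First fix [n] by [trunc_approx], then take alpha so large that the Hilbert-Schmidt defect of
    [sigma] is small compared with c / n. The threshold [M] depends on neither [F] nor [E]. *)
Lemma escape (eps : R) : 0 < eps -> exists M : R, forall alpha, A alpha -> M < alpha ->
  forall (F : seq (J alpha)) (E : set (borel X)), uniq F -> measurable E ->
  (forall j x, j \in F -> E x -> (sigma x - t) ^+ 2 <= (lambda j - sigma x) ^+ 2) ->
  \int[nu]_x (eta x * \1_E x * mass_ F x) <= eps.
Proof.
move=> eps0; have e2 : 0 < eps / 2 by rewrite divr_gt0.
have [n hn] := trunc_approx sigmaL2 eta_ge0 eta_int sigma_t e2.
have n1 : 0 < n.+1%:R :> R by rewrite ltr0n.
(* The successor keeps the tolerance meaningful for n = 0. *)
have en : 0 < eps / 2 / n.+1%:R by rewrite divr_gt0.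
have [M hM] := hs_fullP sigmaL2 (full sigmaL2) en.
exists M => alpha Aa Ma F E uF mE far.
have [F0 [uF0 hF0]] := hM _ Aa Ma; pose G := undup (F ++ F0).
have uG : uniq G by exact: undup_uniq.
have FG : {subset F <= G} by move=> i iF; rewrite mem_undup mem_cat iF.
have F0G : {subset F0 <= G} by move=> i iF; rewrite mem_undup mem_cat iF orbT.
have c0 := c_gt0 Aa.
rewrite -(ler_pM2l c0) -(Rintegral_nua c_gt0 nuaE Aa); last exact: weight_int_nu.
have etaA : rintegrable (nua alpha) eta.
  exact: rintegrable_scaled c0 (nuaE Aa) _ eta_int.
apply: le_trans (weighted_escape (k_frame Aa) (e_basis Aa)
  (L2_nua c_gt0 nuaE Aa sigmaL2) (eigen Aa) eta_ge0 etaA n mE uF uG FG far) _.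
rewrite (Rintegral_nua c_gt0 nuaE Aa); last first.
  apply: rintegrableB => //; exact: (trunc_integrable (mu := nu)).
have le1 := ler_wpM2l (ltW c0) (ltW hn).
have le2 := ler_wpM2l (ler0n R n) (hF0 G uG F0G).
apply: le_trans (lerD le1 le2) _.
have -> : c alpha * eps = c alpha * (eps / 2) + c alpha * (eps / 2) by field.
rewrite lerD2l (_ : n%:R * _ = c alpha * (eps / 2) * (n%:R / n.+1%:R)); last ring.
rewrite ler_piMr//; first by apply: mulr_ge0; exact: ltW.
by rewrite ler_pdivrMr// mul1r ler_nat.
Qed.

(** For alpha in [A] this is c(alpha)^-1 times the sum of <T_eta e_j, e_j> over [F]: integrating
    against [nu] instead of [nua alpha] absorbs the factor. *)
Definition escape_sum alpha (F : seq (J alpha)) : R :=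
  \sum_(j <- F) \int[nu]_x (eta x * fprod (k alpha) (e j) (e j) x).

Lemma term_integrable alpha j : A alpha ->
  rintegrable nu (fun x => eta x * fprod (k alpha) (@e alpha j) (e j) x).
Proof.
move=> Aa; apply: eq_rintegrable (weight_int_nu Aa measurableT (_ : uniq [:: j])) => // x.
by rewrite /mass big_seq1 indicT mulr1.
Qed.

Lemma escape_sumE alpha F : A alpha -> uniq F ->
  escape_sum F = \int[nu]_x (eta x * mass (k alpha) (@e alpha) F x).
Proof.
move=> Aa uF; rewrite /escape_sum -Rintegral_sum => [|j]; last exact: term_integrable.
by apply: eq_Rintegral => x _; rewrite mulr_sumr.
Qed.

Let above : set (borel X) := [set x | t < sigma x].

Let mabove : measurable above.
Proof. exact: measurable_above sigmaL2. Qed.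

Let above_integrable : rintegrable nu (fun x => eta x * \1_above x).
Proof.
apply: (rintegrable_le (g := eta)) => // [|x].
  apply: measurable_funM; last exact: measurable_indic.
  exact: rintegrable_measurable eta_int.
by rewrite ger0_norm ?mulr_ge0// ler_piMr.
Qed.

Lemma weight_split alpha F : A alpha -> uniq F ->
  \int[nu]_x (eta x * mass (k alpha) (@e alpha) F x) =
  \int[nu]_x (eta x * \1_above x * mass (k alpha) (@e alpha) F x) +
  \int[nu]_x (eta x * \1_(~` above) x * mass (k alpha) (@e alpha) F x).
Proof.
move=> Aa uF; rewrite -RintegralD//.
- apply: eq_Rintegral => x _; rewrite !indicE in_setC.
  by case: (_ \in _) => /=; ring.
- exact: weight_int_nu.
- by apply: weight_int_nu => //; exact: measurableC.
Qed.

(** Over {sigma > t} use mass <= 1. On the complement sigma x <= t < lambda_j, so t lies between the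
    two and [escape] applies. *)
Lemma counting_upper (eps : R) : 0 < eps -> exists M : R,
  forall alpha, A alpha -> M < alpha -> forall F : seq (J alpha), uniq F ->
  (forall j, j \in F -> t < lambda j) ->
  escape_sum F <= \int[nu]_x (eta x * \1_above x) + eps.
Proof.
move=> eps0; have [M hM] := escape eps0; exists M => alpha Aa Ma F uF Ft.
rewrite escape_sumE// weight_split// lerD//; last first.
  apply: hM => //; first exact: measurableC.
  move=> j x jF /= /negP; rewrite -leNgt => xt; have := Ft j jF => tj.
  nra.
apply: le_Rintegral => //; first exact: weight_int_nu.
move=> x _; apply: ler_piMr; first exact: mulr_ge0.
exact: (mass_le1 (k_frame Aa) (e_basis Aa) x uF).
Qed.

(** A finite set [G] captures almost all of eta on {sigma > t}. Its indices with lambda_j <= t carry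
    little of that mass by [escape], so those with lambda_j > t carry the rest. *)
Lemma counting_lower (eps : R) : 0 < eps -> exists M : R,
  forall alpha, A alpha -> M < alpha -> exists F : seq (J alpha), [/\ uniq F,
  forall j, j \in F -> t < lambda j &
  \int[nu]_x (eta x * \1_above x) - eps <= escape_sum F].
Proof.
move=> eps0; have e2 : 0 < eps / 2 by rewrite divr_gt0.
(* The square root turns the integrable weight into a square integrable symbol, to which [full] and
   [tail_le] apply. *)
pose psi x := Num.sqrt (eta x * \1_above x).
have psi2 x : psi x ^+ 2 = eta x * \1_above x by rewrite sqr_sqrtr// mulr_ge0.
have Lpsi : L2 nu psi.
  split; last by apply: eq_rintegrable above_integrable => x; rewrite -psi2.
  apply: (measurableT_comp (continuous_measurable_fun (@sqrt_continuous R))).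
  exact: rintegrable_measurable above_integrable.
have [M1 hM1] := full Lpsi e2; have [M2 hM2] := escape e2.
exists (Num.max M1 M2) => alpha Aa; rewrite gt_max => /andP[Ma1 Ma2].
have [G [uG hG]] := hM1 _ Aa Ma1.
have LA := L2_nua c_gt0 nuaE Aa Lpsi; have c0 := c_gt0 Aa.
pose F := [seq j <- G | t < lambda j]; pose F' := [seq j <- G | ~~ (t < lambda j)].
have uF : uniq F by exact: filter_uniq.
have uF' : uniq F' by exact: filter_uniq.
exists F; split=> // [j|]; first by rewrite mem_filter => /andP[].
have massD x : mass_ G x = mass_ F x + mass_ F' x.
  by rewrite /mass !big_filter (bigID (fun j => t < lambda j)).
have := le_trans (tail_le (@e alpha) (k_frame Aa) G LA) hG.
have -> : \int[nua alpha]_x (psi x ^+ 2 * (1 - mass_ G x)) =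
  c alpha * (\int[nu]_x (eta x * \1_above x) -
     \int[nu]_x (eta x * \1_above x * mass_ G x)).
  rewrite -RintegralB//; last exact: weight_int_nu.
  rewrite -(Rintegral_nua c_gt0 nuaE Aa); last first.
    by apply: rintegrableB => //; exact: weight_int_nu.
  by apply: eq_Rintegral => x _; rewrite psi2; ring.
rewrite [leRHS]mulrC ler_pM2l// => hmass.
have massGE : \int[nu]_x (eta x * \1_above x * mass_ G x) =
   \int[nu]_x (eta x * \1_above x * mass_ F x) +
   \int[nu]_x (eta x * \1_above x * mass_ F' x).
  rewrite -RintegralD//; [|exact: weight_int_nu..].
  by apply: eq_Rintegral => x _; rewrite massD mulrDr.
have le1 : \int[nu]_x (eta x * \1_above x * mass_ F' x) <= eps / 2.
  apply: hM2 => // j x; rewrite mem_filter -leNgt => /andP[jt _] xt.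
  have {}xt : t < sigma x by exact: xt.
  nra.
have le2 : \int[nu]_x (eta x * \1_above x * mass_ F x) <= escape_sum F.
  rewrite escape_sumE// weight_split// lerDl; apply: Rintegral_ge0 => x _.
  by apply: mulr_ge0; [exact: mulr_ge0|exact: mass_ge0].
have arith (a b f f' s : R) : a - b <= eps / 2 -> b = f + f' -> f' <= eps / 2 ->
  f <= s -> a - eps <= s by lra.
exact: arith hmass massGE le1 le2.
Qed.

End counting.

Theorem corollary5p4 (R : realType) (X : ptopologicalType)
    (X_lc : locally_compact [set: X]) (X_hausdorff : hausdorff_space X)
    (* the parameter alpha ranges over an unbounded set A of real numbers *)
    (A : set R) (A_unbounded : forall M : R, exists2 alpha, A alpha & M < alpha)
    (H : R -> hilbert R) (k : forall alpha : R, X -> H alpha)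
    (nua : R -> {measure set (borel X) -> \bar R})
    (nua_radon : forall alpha, A alpha -> radon_measure (nua alpha))
    (k_frame : forall alpha, A alpha ->
       normalized_parseval_frame (nua alpha) (k alpha))
    (c : R -> R) (c_gt0 : forall alpha, A alpha -> 0 < c alpha)
    (nu : {measure set (borel X) -> \bar R}) (nu_radon : radon_measure nu)
    (nuaE : forall alpha, A alpha -> forall B : set (borel X), measurable B ->
       nua alpha B = ((c alpha)%:E * nu B)%E)
    (k_localized : forall (x : X) (U : set (borel X)),
       nbhs x (U : set X) -> measurable U ->
       (\int[nua alpha]_(y in ~` U)
          (complex.Re (`|'<k alpha x, k alpha y>| ^+ 2))%:E)%E
         @[alpha --> within A (pinfty_nbhs R)] --> 0%E)
    (sigma : borel X -> R)
    (sigma_L1 : sigma \in Lfun nu 1%E) (sigma_L2 : sigma \in Lfun nu 2%:E)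
    (sigma_bounded_or_ge0 :
       (exists M : R, {ae nu, forall x, `|sigma x| <= M}) \/
       {ae nu, forall x, 0 <= sigma x})
    (t : R) (sigma_t : nu [set x | sigma x = t] = 0%E)
    (eta : borel X -> R)
    (eta_L1 : eta \in Lfun nu 1%E) (eta_L2 : eta \in Lfun nu 2%:E)
    (eta_ge0 : {ae nu, forall x, 0 <= eta x})
    (T_commute : forall alpha, A alpha -> forall f : H alpha,
       toeplitz (nua alpha) (k alpha) (fun x => (sigma x)%:C)
         (toeplitz (nua alpha) (k alpha) (fun x => (eta x)%:C) f) =
       toeplitz (nua alpha) (k alpha) (fun x => (eta x)%:C)
         (toeplitz (nua alpha) (k alpha) (fun x => (sigma x)%:C) f))
    (J : R -> choiceType) (e : forall alpha : R, J alpha -> H alpha)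
    (lambda : forall alpha : R, J alpha -> R)
    (e_eigenbasis : forall alpha, A alpha ->
       orthonormal_eigenbasis
         (toeplitz (nua alpha) (k alpha) (fun x => (sigma x)%:C))
         (e alpha) (lambda alpha)) :
  (((c alpha)^-1)%:E *
     \esum_(j in [set j | (t < lambda alpha j)%R])
       (complex.Re '<toeplitz (nua alpha) (k alpha) (fun x => (eta x)%:C)
                       (e alpha j), e alpha j>)%:E)%E
    @[alpha --> within A (pinfty_nbhs R)] -->
  (\int[nu]_(x in [set x | (t < sigma x)%R]) (eta x)%:E)%E.
Proof.
(* [eta] is nonnegative only almost everywhere; its absolute value is nonnegative everywhere and has
   the same integrals. *)
pose et x := `|eta x|.
have et_ge0 x : 0 <= et x by exact: normr_ge0.
have Lfun_L2 (f : borel X -> R) : f \in Lfun nu 2%:E -> L2 nu f.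
  move=> f2; split; last exact: Lfun2_integrable_sqr.
  by have := sub_Lfun_mfun f2; rewrite inE.
have sigmaL2 := Lfun_L2 _ sigma_L2; have etaL2 := Lfun_L2 _ eta_L2.
have etaI : rintegrable nu eta by exact/Lfun1_integrable.
have etI : rintegrable nu et by exact: integrable_norm.
have [meta met] := (rintegrable_measurable etaI, rintegrable_measurable etI).
have e_basis alpha (Aa : A alpha) := (e_eigenbasis alpha Aa).1.
have eigen alpha (Aa : A alpha) := (e_eigenbasis alpha Aa).2.
have eta_et (f : borel X -> R) : measurable_fun setT f ->
    \int[nu]_x (eta x * f x) = \int[nu]_x (et x * f x).
  move=> mf; congr fine; apply: ae_eq_integral => //.
  - by apply/measurable_EFinP; exact: measurable_funM.
  - by apply/measurable_EFinP; exact: measurable_funM.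
  - by apply: filterS eta_ge0 => x x0 _; rewrite /et ger0_norm.
have full psi : L2 nu psi -> @hs_full R X A H J k e nua c psi.
  exact: (hs_full_L2 k_frame e_basis c_gt0 nuaE k_localized (radon_outer nu_radon)).
pose T_ alpha j := \int[nu]_x (et x * fprod (k alpha) (e alpha j) (e alpha j) x).
have termE alpha j : A alpha -> complex.Re
    '<toeplitz (nua alpha) (k alpha) (fun x => (eta x)%:C) (e alpha j), e alpha j> =
    c alpha * T_ alpha j.
  move=> Aa; have etaA := L2_nua c_gt0 nuaE Aa etaL2.
  have mint := mul_fprod_integrable (k_frame _ Aa) (e alpha j) (e alpha j) etaA.
  rewrite -/(ip _ _) (ip_toeplitz (k_frame _ Aa))// (Rintegral_nua c_gt0 nuaE Aa).
    by rewrite eta_et//; exact: measurable_fprod (k_frame _ Aa) _ _.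
  exact: rintegrable_nu c_gt0 nuaE _ _ Aa mint.
pose above : set (borel X) := [set x | t < sigma x].
have mabove : measurable above by exact: measurable_above sigmaL2.
have -> : (\int[nu]_(x in above) (eta x)%:E = (\int[nu]_x (et x * \1_above x))%:E)%E.
  rewrite -eta_et; last exact: measurable_indic.
  rewrite integral_mkcond /Rintegral fineK; last first.
    apply: integrable_fin_num => //.
    apply: (rintegrable_le (g := et)) etI => [|x].
      by apply: measurable_funM => //; exact: measurable_indic.
    by rewrite normrM ler_piMr// ger0_norm.
  apply: eq_integral => x _; rewrite patchE indicE.
  by case: (_ \in _); rewrite ?mulr1 ?mulr0.
set I := \int[nu]_x (et x * \1_above x).
set V := fun alpha => _.
(* The sum over all lambda_j > t is a supremum over finite subsets: [counting_lower] exhibits one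
   that is large enough, and [counting_upper] bounds them all. *)
have bounds eps : 0 < eps -> exists M : R, forall alpha, A alpha -> M < alpha ->
    ((I - eps)%:E <= V alpha)%E /\ (V alpha <= (I + eps)%:E)%E.
  move=> eps0.
  have [M1 hM1] := counting_upper k_frame e_basis c_gt0 nuaE full sigmaL2 et_ge0 etI
    sigma_t eigen eps0.
  have [M2 hM2] := counting_lower k_frame e_basis c_gt0 nuaE full sigmaL2 et_ge0 etI
    sigma_t eigen eps0.
  exists (Num.max M1 M2) => alpha Aa; rewrite gt_max => /andP[Ma1 Ma2].
  have c0 := c_gt0 _ Aa.
  have VE (x : R) : (x%:E = (c alpha)^-1%:E * (c alpha * x)%:E)%E.
    by rewrite -EFinM mulKf// gt_eqF.
  have cV : (0 <= (c alpha)^-1%:E)%E by rewrite lee_fin invr_ge0 ltW.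
  have sumE (F : seq (J alpha)) : (\sum_(j <- F) (complex.Re
      '<toeplitz (nua alpha) (k alpha) (fun x => (eta x)%:C) (e alpha j), e alpha j>)%:E =
      (c alpha * \sum_(j <- F) T_ alpha j)%:E)%E.
    by rewrite mulr_sumr -sumEFin; apply: eq_bigr => j _; rewrite termE.
  split.
    have [F [uF Ft hF]] := hM2 _ Aa Ma2.
    rewrite VE; apply: lee_wpmul2l => //; apply: esum_ge.
    exists [set` F]; first by split; [exact: finite_seq|move=> j /= /Ft].
    by rewrite -fsbig_seq// sumE lee_fin ler_pM2l.
  rewrite [leRHS]VE; apply: lee_wpmul2l => //.
  apply: ge_ereal_sup => _ [B [finB Bt] <-].
  rewrite fsbig_finite// sumE lee_fin ler_pM2l//.
  apply: hM1 => // j; rewrite in_fset_set// => /set_mem; exact: Bt.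
have nearM M : \forall alpha \near within A (pinfty_nbhs R), A alpha /\ M < alpha.
  rewrite near_withinE; near=> alpha => Aa; split=> //.
  by near: alpha; apply: nbhs_pinfty_gt; exact: num_real.
(* [V] takes extended real values; finiteness for large alpha reduces the limit to convergence of
   real numbers. *)
have fin eps alpha : ((I - eps)%:E <= V alpha)%E ->
    (V alpha <= (I + eps)%:E)%E -> V alpha \is a fin_num.
  move=> l u; apply/fin_numPlt/andP; split.
    exact: lt_le_trans (ltNyr _) l.
  exact: le_lt_trans u (ltry _).
apply/fine_cvgP; split.
  have [M hM] := bounds 1 ltr01.
  apply: filterS (nearM M) => alpha [Aa Ma]; have [l u] := hM _ Aa Ma.
  exact: fin l u.
apply/cvgrPdist_le => eps eps0; have [M hM] := bounds _ eps0.
apply: filterS (nearM M) => alpha [Aa Ma]; have [l u] := hM _ Aa Ma.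
have Vfin := fin _ _ l u.
move: l u; rewrite /= -(fineK Vfin) !lee_fin => l u.
by rewrite distrC ler_distl; apply/andP.
Unshelve. all: by end_near. Qed.
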